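(* Multistage 2-SAT (with $d\le n$) is solvable in $O(4^{2(m+n-d)}\,\tau\,(n+m))$ time.
   Context: A 2-CNF formula is a conjunction of clauses, each a disjunction of at most two literals (variables or negated variables). Multistage 2-SAT: the input is a set $X$ of variables, a sequence $\Phi=(\phi_1,\dots,\phi_\tau)$, $\tau\ge 1$, of 2-CNF formulas (the ''stages'') over literals over $X$, and an integer $d\ge 0$. The question is whether there are $\tau$ truth assignments $f_1,\dots,f_\tau\colon X\to\{\bot,\top\}$ such that (i) for each $i\in\{1,\dots,\tau\}$, $f_i$ satisfies $\phi_i$, and (ii) for each $i\in\{1,\dots,\tau-1\}$, $|\{x\in X\mid f_i(x)\ne f_{i+1}(x)\}|\le d$. Here $n=|X|$ is the number of variables and $m$ is the maximum number of clauses in any stage. *)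

(* Defs.v *)
From mathcomp Require Import all_boot.

Set Implicit Arguments.
Unset Strict Implicit.
Unset Printing Implicit Defensive.

(** * Multistage 2-SAT *)

(* The variable set X is 'I_n; the literal (x, b) is satisfied by f when
   f x = b, so (x, false) is the negation of x. *)
Definition literal (n : nat) := ('I_n * bool)%type.

(* At most two literals; the empty clause is allowed and is unsatisfiable. *)
Definition clause (n : nat) := 2.-bseq (literal n).

Definition formula (n : nat) := seq (clause n).

Definition assignment (n : nat) := {ffun 'I_n -> bool}.

Definition sat_clause (n : nat) (f : assignment n) (c : clause n) : bool :=
  has (fun l : literal n => f l.1 == l.2) c.

Definition sat_formula (n : nat) (f : assignment n) (phi : formula n) : bool :=
  all (sat_clause f) phi.

Definition multistage_2sat (n tau d : nat) (Phi : tau.-tuple (formula n))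
    : Prop :=
  exists f : 'I_tau -> assignment n,
    (forall i : 'I_tau, sat_formula (f i) (tnth Phi i)) /\
    (forall i j : 'I_tau, j = i.+1 :> nat ->
       #|[set x | f i x != f j x]| <= d).

Definition max_clauses (n tau : nat) (Phi : tau.-tuple (formula n)) : nat :=
  \max_(i < tau) size (tnth Phi i).

(** * Random access machines *)

(* The uniform-cost RAM of Cook and Reckhow (1973): every instruction costs
   one time unit, and the arithmetic is restricted to addition and
   subtraction.  Registers hold natural numbers, so subtraction is truncated;
   the PRINT instruction is replaced by the two halting instructions. *)
Inductive instr :=
  | Const of nat & nat          (* X_i <- c *)
  | Plus of nat & nat & nat     (* X_i <- X_j + X_k *)
  | Monus of nat & nat & nat    (* X_i <- X_j - X_k *)
  | Fetch of nat & nat          (* X_i <- X_(X_j) *)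
  | Store of nat & nat          (* X_(X_i) <- X_j *)
  | Jump of nat & nat           (* go to instruction l if X_i > 0 *)
  | Read of nat                 (* X_i <- next number on the input tape *)
  | Accept
  | Reject.

Definition program := seq instr.

Record config := Config {
  counter : nat;
  regs : nat -> nat;
  tape : seq nat
}.

Definition init (input : seq nat) : config := Config 0 (fun _ => 0) input.

(* Reading past the end of the tape yields 0. *)
Definition exec (ins : instr) (c : config) : config :=
  let: Config pc X w := c in
  match ins with
  | Const i a => Config pc.+1 [eta X with i |-> a] w
  | Plus i j k => Config pc.+1 [eta X with i |-> X j + X k] w
  | Monus i j k => Config pc.+1 [eta X with i |-> X j - X k] w
  | Fetch i j => Config pc.+1 [eta X with i |-> X (X j)] w
  | Store i j => Config pc.+1 [eta X with X i |-> X j] w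
  | Jump i l => Config (if 0 < X i then l else pc.+1) X w
  | Read i => Config pc.+1 [eta X with i |-> head 0 w] (behead w)
  | Accept | Reject => c
  end.

(* [run P t c = Some b] iff P, started in c, executes at most t instructions,
   the last of which is Accept (b = true) or Reject (b = false).  A program
   whose counter leaves the program text never halts. *)
Fixpoint run (P : program) (t : nat) (c : config) : option bool :=
  if t is t'.+1 then
    match onth P (counter c) with
    | None => None
    | Some Accept => Some true
    | Some Reject => Some false
    | Some ins => run P t' (exec ins c)
    end
  else None.

Definition decides_within (P : program) (input : seq nat) (t : nat)
    (Q : Prop) : Prop :=
  exists2 b : bool, run P t (init input) = Some b & (b <-> Q).

(** * Input encoding *)

(* Every list is preceded by its length; each literal takes one number. *)
Definition encode_literal (n : nat) (l : literal n) : nat := l.1.*2 + l.2.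

Definition encode_clause (n : nat) (c : clause n) : seq nat :=
  size c :: [seq encode_literal l | l <- c].

Definition encode_formula (n : nat) (phi : formula n) : seq nat :=
  size phi :: flatten [seq encode_clause c | c <- phi].

Definition encode (n tau d : nat) (Phi : tau.-tuple (formula n)) : seq nat :=
  [:: n, d, tau & flatten [seq encode_formula phi | phi <- Phi]].

(* Main.v *)
(* If d >= 4m, consecutive stages do not interact: each satisfiable stage has a
   solution with at most 2m true variables, and two of those differ in at most
   4m places.  It then suffices to try the 2^(2m) values of the literal
   occurrences of every stage.  If d < 4m, then n <= 4m + (n - d), and dynamic
   programming over all 2^n assignments is affordable: the distances of all
   assignments to the set of reachable ones are computed by n passes over the
   hypercube, one per coordinate, in O(2^n n) time.  Both cases run the same
   program on bit patterns of length 2m or n; in the first case the distance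
   bound is made void.

   The program is written in a language of counting loops, whose semantics is a
   total function, and compiled to the RAM with constant overhead. *)
Require Import Defs.
From mathcomp Require Import all_boot.
From mathcomp Require Import zify.

Set Implicit Arguments.
Unset Strict Implicit.
Unset Printing Implicit Defensive.

(** * A language of counting loops *)

(** Either pattern length gives at most [2 ^ (4 * (m + n - d))], that is [4 ^ (2 * (m + n - d))],
    patterns: length [2 * m] because [d <= n], length [n] because [d < 4 * m]. The remaining linear
    factor leaves [O(n + m)] steps per pattern and stage, on a machine that can neither multiply nor
    shift right. Bits are therefore extracted from the top, by doubling and comparing with [2 ^ N],
    and each relaxation pass rotates the patterns, so that the only indices to compute are [i],
    [i + 2 ^ (N - 1)], [2 * i] and [2 * i + 1]. Before relaxation, a pattern that cannot end the
    stages seen so far gets the value [N + 1], which exceeds every distance between patterns; the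
    distance table is accordingly specified only through thresholds [e <= N]. The truth table and
    the list of controlled variables are never reset between stages, so acceptance of a pattern has
    to be shown independent of their leftovers. *)

Inductive expr :=
  | Cst of nat
  | Var of nat
  | Arr of nat & expr
  | Sum of expr & expr
  | Diff of expr & expr.

Inductive cmd :=
  | Assign of nat & expr
  | Update of nat & expr & expr
  | Input of nat
  | Then of cmd & cmd
  | For of nat & expr & cmd.

Record store := MkStore {
  var : nat -> nat;
  arr : nat -> nat -> nat;
  stream : seq nat
}.

Definition setv (s : store) (x v : nat) : store :=
  MkStore [eta var s with x |-> v] (arr s) (stream s).

Definition seta (s : store) (a i v : nat) : store :=
  MkStore (var s)
    (fun b j => if (b == a) && (j == i) then v else arr s b j) (stream s).

Definition popv (s : store) (x : nat) : store :=
  MkStore [eta var s with x |-> head 0 (stream s)] (arr s) (behead (stream s)).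

Fixpoint eval (s : store) (e : expr) : nat :=
  match e with
  | Cst v => v
  | Var x => var s x
  | Arr a e => arr s a (eval s e)
  | Sum e1 e2 => eval s e1 + eval s e2
  | Diff e1 e2 => eval s e1 - eval s e2
  end.

Fixpoint countdown (x : nat) (body : store -> store) (k : nat) (s : store) :=
  if k is k'.+1 then countdown x body k' (body (setv s x k')) else s.

Fixpoint countdown_cost (x : nat) (body : store -> store)
    (body_cost : store -> nat) (k : nat) (s : store) : nat :=
  if k is k'.+1 then
    let s' := setv s x k' in
    (body_cost s' + countdown_cost x body body_cost k' (body s')).+1
  else 0.

(* The loop variable of [For x e c] runs from [eval s e - 1] down to 0. *)
Fixpoint den (c : cmd) (s : store) : store :=
  match c with
  | Assign x e => setv s x (eval s e)
  | Update a i e => seta s a (eval s i) (eval s e)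
  | Input x => popv s x
  | Then c1 c2 => den c2 (den c1 s)
  | For x e c => countdown x (den c) (eval s e) (setv s x (eval s e))
  end.

(** Evaluating an expression is not charged by its size: that size depends on the program alone and
    goes into the constant of the compilation. *)
Fixpoint cost (c : cmd) (s : store) : nat :=
  match c with
  | Assign _ _ | Update _ _ _ | Input _ => 1
  | Then c1 c2 => cost c1 s + cost c2 (den c1 s)
  | For x e c =>
      (countdown_cost x (den c) (cost c) (eval s e) (setv s x (eval s e))).+1
  end.

Fixpoint wvars (c : cmd) : seq nat :=
  match c with
  | Assign x _ | Input x => [:: x]
  | Update _ _ _ => [::]
  | Then c1 c2 => wvars c1 ++ wvars c2
  | For x _ c => x :: wvars c
  end.

Fixpoint warrs (c : cmd) : seq nat :=
  match c with
  | Assign _ _ | Input _ => [::]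
  | Update a _ _ => [:: a]
  | Then c1 c2 => warrs c1 ++ warrs c2
  | For _ _ c => warrs c
  end.

Fixpoint wf_expr (e : expr) : bool :=
  match e with
  | Cst _ | Var _ => true
  | Arr a e => (a < 14) && wf_expr e
  | Sum e1 e2 | Diff e1 e2 => wf_expr e1 && wf_expr e2
  end.

(** The compiled loop keeps its count in the register of [x] itself, so the body must leave [x]
    alone. Fourteen arrays are what remains of the 16 residue classes after the temporaries and the
    variables. *)
Fixpoint wf_cmd (c : cmd) : bool :=
  match c with
  | Assign _ e => wf_expr e
  | Update a i e => [&& a < 14, wf_expr i & wf_expr e]
  | Input _ => true
  | Then c1 c2 => wf_cmd c1 && wf_cmd c2
  | For x e c => [&& wf_expr e, x \notin wvars c & wf_cmd c]
  end.

Lemma frame_var (c : cmd) (s : store) (x : nat) :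
  x \notin wvars c -> var (den c s) x = var s x.
Proof.
elim: c s => [y e|a i e|y|c1 IH1 c2 IH2|y e c IH] s /=.
- by rewrite inE => /negPf ->.
- by [].
- by rewrite inE => /negPf ->.
- by rewrite mem_cat negb_or => /andP[x1 x2]; rewrite IH2 // IH1.
rewrite inE negb_or => /andP[/negPf xy xc].
have: var (setv s y (eval s e)) x = var s x by rewrite /= xy.
move: (setv _ _ _) => s'; elim: (eval s e) s' => [//|k IHk] s' Es' /=.
by apply: IHk; rewrite IH //= xy.
Qed.

Lemma frame_arr (c : cmd) (s : store) (a : nat) :
  a \notin warrs c -> arr (den c s) a = arr s a.
Proof.
elim: c s => [y e|b i e|y|c1 IH1 c2 IH2|y e c IH] s //=.
- by rewrite inE => /negPf ->.
- by rewrite mem_cat negb_or => /andP[x1 x2]; rewrite IH2 // IH1.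
move=> ac; have: arr (setv s y (eval s e)) a = arr s a by [].
move: (setv _ _ _) => s'; elim: (eval s e) s' => [//|k IHk] s' Es' /=.
by apply: IHk; rewrite IH.
Qed.

(** * Compilation *)

(* Memory is interleaved: the temporaries are the registers 16 t, the
   variables 16 x + 1, and the cells of array a the registers 16 i + a + 2. *)
Definition tmp (t : nat) : nat := 16 * t.
Definition vreg (x : nat) : nat := 16 * x + 1.
Definition areg (a i : nat) : nat := 16 * i + a.+2.

(** Four doublings replace a multiplication by 16; this is why memory is interleaved with a power of
    two as period. *)
Definition address (t a : nat) : seq instr :=
  [:: Plus (tmp t) (tmp t) (tmp t); Plus (tmp t) (tmp t) (tmp t);
      Plus (tmp t) (tmp t) (tmp t); Plus (tmp t) (tmp t) (tmp t);
      Const (tmp t.+1) a.+2; Plus (tmp t) (tmp t) (tmp t.+1)].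

(** Only temporaries from [t] on are overwritten, so a left operand in [tmp t] survives the
    evaluation of the right one. Adding a zero register plays the role of a move instruction. *)
Fixpoint ecode (t : nat) (e : expr) : seq instr :=
  match e with
  | Cst v => [:: Const (tmp t) v]
  | Var x => [:: Const (tmp t) 0; Plus (tmp t) (vreg x) (tmp t)]
  | Arr a e => (ecode t e ++ address t a) ++ [:: Fetch (tmp t) (tmp t)]
  | Sum e1 e2 => ecode t e1 ++ ecode t.+1 e2
      ++ [:: Plus (tmp t) (tmp t) (tmp t.+1)]
  | Diff e1 e2 => ecode t e1 ++ ecode t.+1 e2
      ++ [:: Monus (tmp t) (tmp t) (tmp t.+1)]
  end.

Definition assign_code (x : nat) (e : expr) : seq instr :=
  ecode 0 e ++ [:: Const (tmp 1) 0; Plus (vreg x) (tmp 0) (tmp 1)].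

Definition update_code (a : nat) (i e : expr) : seq instr :=
  ecode 0 i ++ address 0 a ++ ecode 1 e ++ [:: Store (tmp 0) (tmp 1)].

Fixpoint csize (c : cmd) : nat :=
  match c with
  | Assign x e => size (assign_code x e)
  | Update a i e => size (update_code a i e)
  | Input _ => 1
  | Then c1 c2 => csize c1 + csize c2
  | For x e c => size (assign_code x e) + csize c + 5
  end.

(** The loop test sits at the bottom and is entered by a jump on a constant 1, so that a loop of
    zero rounds skips its body. The counter is decremented before the body, which therefore sees the
    values from the bound minus one down to 0. *)
Fixpoint ccode (pc : nat) (c : cmd) : seq instr :=
  match c with
  | Assign x e => assign_code x e
  | Update a i e => update_code a i e
  | Input x => [:: Read (vreg x)]
  | Then c1 c2 => ccode pc c1 ++ ccode (pc + csize c1) c2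
  | For x e c =>
      let l := pc + size (assign_code x e) + 2 in
      assign_code x e
      ++ [:: Const (tmp 0) 1; Jump (tmp 0) (l + 2 + csize c)]
      ++ [:: Const (tmp 0) 1; Monus (vreg x) (vreg x) (tmp 0)]
      ++ ccode (l + 2) c ++ [:: Jump (vreg x) l]
  end.

Lemma size_ccode (pc : nat) (c : cmd) : size (ccode pc c) = csize c.
Proof.
elim: c pc => [x e|a i e|x|c1 IH1 c2 IH2|x e c IH] pc //=.
  by rewrite size_cat IH1 IH2.
by rewrite size_cat /= size_cat IH /=; lia.
Qed.

Definition code_at (P : program) (pc : nat) (code : seq instr) : Prop :=
  forall k, k < size code -> onth P (pc + k) = onth code k.

Lemma code_at_cat (P : program) (pc : nat) (u v : seq instr) :
  code_at P pc (u ++ v) -> code_at P pc u /\ code_at P (pc + size u) v.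
Proof.
move=> H; split=> k lt_k.
  rewrite H; last by rewrite size_cat; lia.
  by rewrite onth_cat lt_k.
rewrite -addnA H; last by rewrite size_cat; lia.
by rewrite onth_cat ifF ?addKn //; lia.
Qed.

Definition straight (i : instr) : bool :=
  match i with Jump _ _ | Accept | Reject => false | _ => true end.

Lemma run_straight (P : program) (code : seq instr) (cf : config) (u : nat) :
  all straight code -> code_at P (counter cf) code ->
  run P (size code + u) cf = run P u (foldl (fun c i => exec i c) cf code)
  /\ counter (foldl (fun c i => exec i c) cf code) = counter cf + size code.
Proof.
elim: code cf => [|i code IH] cf /=; first by rewrite addn0.
case/andP=> si scode H.
have Hi : onth P (counter cf) = Some i by have := H 0 isT; rewrite addn0.
have Hc : counter (exec i cf) = (counter cf).+1 by case: cf {H Hi} => ? ? ?; case: i si.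
have /(IH _ scode)[E1 E2] : code_at P (counter (exec i cf)) code.
  by move=> k lt_k; rewrite Hc addSnnS H.
rewrite Hi E2 Hc addSnnS; split=> //; rewrite -E1.
by case: (i) si.
Qed.

Notation execs := (foldl (fun c i => exec i c)).

Lemma straight_ecode (t : nat) (e : expr) : all straight (ecode t e).
Proof.
elim: e t => [v|x|a e IH|e1 IH1 e2 IH2|e1 IH1 e2 IH2] t //=;
  by rewrite !all_cat ?IH ?IH1 ?IH2.
Qed.

Definition represents (s : store) (cf : config) : Prop :=
  [/\ forall x, regs cf (vreg x) = var s x,
      forall a i, a < 14 -> regs cf (areg a i) = arr s a i &
      tape cf = stream s].

Definition same_from (t : nat) (cf cf' : config) : Prop :=
  (forall r, (forall u, t <= u -> r <> tmp u) -> regs cf' r = regs cf r)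
  /\ tape cf' = tape cf.

Lemma same_from_trans (t t' : nat) (cf cf' cf'' : config) :
  t <= t' -> same_from t cf cf' -> same_from t' cf' cf'' -> same_from t cf cf''.
Proof.
move=> le_tt' [r1 w1] [r2 w2]; split; last by rewrite w2.
by move=> r Hr; rewrite r2 ?r1 // => u le_t'u; apply: Hr; apply: leq_trans le_t'u.
Qed.

Lemma same_from_represents (t : nat) (s : store) (cf cf' : config) :
  same_from t cf cf' -> represents s cf -> represents s cf'.
Proof.
move=> [Er Ew] [Hv Ha Hw]; split=> [x|a i lt_a|]; last by rewrite Ew.
  by rewrite Er // => u _; rewrite /vreg /tmp; lia.
by rewrite Er ?Ha // => u _; rewrite /areg /tmp; lia.
Qed.

Lemma eqn_false (i j : nat) : i <> j -> (i == j) = false.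
Proof. by move/eqP/negPf. Qed.

Lemma address_ok (t a : nat) (cf : config) :
  regs (execs cf (address t a)) (tmp t) = areg a (regs cf (tmp t))
  /\ same_from t cf (execs cf (address t a)).
Proof.
case: cf => pc X w; split=> /=.
  rewrite !eqxx (eqn_false (_ : tmp t <> tmp t.+1)) /= ?eqxx; rewrite /tmp /areg; lia.
split=> //= r Hr.
by rewrite !(eqn_false (Hr t _)) // !(eqn_false (Hr t.+1 _)).
Qed.

Lemma ecode_ok (t : nat) (e : expr) (s : store) (cf : config) :
  wf_expr e -> represents s cf ->
  regs (execs cf (ecode t e)) (tmp t) = eval s e
  /\ same_from t cf (execs cf (ecode t e)).
Proof.
elim: e t cf => [v|x|a e IH|e1 IH1 e2 IH2|e1 IH1 e2 IH2] t cf /=.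
- case: cf => pc X w _ _ /=; rewrite eqxx; split=> //; split=> //= r Hr.
  by rewrite (eqn_false (Hr t _)).
- case: cf => pc X w _ [Hv _ _] /=; rewrite !eqxx addn0.
  rewrite (eqn_false (_ : vreg x <> tmp t)); last by rewrite /vreg /tmp; lia.
  split; first exact: Hv.
  by split=> //= r Hr; rewrite !(eqn_false (Hr t _)).
- case/andP=> lt_a wf_e Hs; have [E1 F1] := IH t cf wf_e Hs.
  rewrite !foldl_cat.
  move: E1 F1; set cf1 := execs cf _ => E1 F1.
  have [E2 F2] := address_ok t a cf1.
  move: E2 F2; set cf2 := execs cf1 _ => E2 F2.
  have F := same_from_trans (leqnn t) F1 F2.
  have [_ Ha _] := same_from_represents F Hs.
  move: E2 Ha F; case: (cf2) => pc X w /= E2 Ha F; rewrite eqxx E2 E1 Ha //; split=> //.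
  apply: same_from_trans (leqnn t) F _; split=> //= r Hr.
  by rewrite (eqn_false (Hr t _)).
- case/andP=> wf1 wf2 Hs; have [E1 F1] := IH1 t cf wf1 Hs.
  rewrite !foldl_cat; move: E1 F1; set cf1 := execs cf _ => E1 F1.
  have [E2 F2] := IH2 t.+1 cf1 wf2 (same_from_represents F1 Hs).
  move: E2 F2; set cf2 := execs cf1 _ => E2 F2.
  have F := same_from_trans (leqnSn t) F1 F2.
  have E3 : regs cf2 (tmp t) = regs cf1 (tmp t).
    by case: F2 => -> // u; rewrite /tmp; lia.
  move: E2 E3 F; case: (cf2) => pc X w /= E2 E3 F; rewrite eqxx E2 E3 E1; split=> //.
  apply: same_from_trans (leqnn t) F _; split=> //= r Hr.
  by rewrite (eqn_false (Hr t _)).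
- case/andP=> wf1 wf2 Hs; have [E1 F1] := IH1 t cf wf1 Hs.
  rewrite !foldl_cat; move: E1 F1; set cf1 := execs cf _ => E1 F1.
  have [E2 F2] := IH2 t.+1 cf1 wf2 (same_from_represents F1 Hs).
  move: E2 F2; set cf2 := execs cf1 _ => E2 F2.
  have F := same_from_trans (leqnSn t) F1 F2.
  have E3 : regs cf2 (tmp t) = regs cf1 (tmp t).
    by case: F2 => -> // u; rewrite /tmp; lia.
  move: E2 E3 F; case: (cf2) => pc X w /= E2 E3 F; rewrite eqxx E2 E3 E1; split=> //.
  apply: same_from_trans (leqnn t) F _; split=> //= r Hr.
  by rewrite (eqn_false (Hr t _)).
Qed.

Lemma assign_code_ok (x : nat) (e : expr) (s : store) (cf : config) :
  wf_expr e -> represents s cf ->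
  represents (setv s x (eval s e)) (execs cf (assign_code x e)).
Proof.
move=> wf_e Hs; have [E F] := ecode_ok 0 wf_e Hs.
rewrite /assign_code foldl_cat; move: E F; set cf1 := execs cf _ => E F.
have := same_from_represents F Hs.
case: cf1 E F => pc X w /= E F [Hv Ha Hw] {F}; split=> //= [y|a i lt_a].
  rewrite {1}/vreg {1}/vreg eqn_add2r eqn_mul2l /=.
  case: eqP => _; first by rewrite E addn0.
  by rewrite eqn_false ?Hv // /vreg /tmp; lia.
have [-> ->] : (areg a i == vreg x) = false /\ (areg a i == tmp 1) = false.
  by split; apply: eqn_false; rewrite /areg /vreg /tmp; lia.
exact: Ha.
Qed.

Lemma areg_inj (a b i j : nat) : a < 14 -> b < 14 ->
  areg a i = areg b j -> a = b /\ i = j.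
Proof. by rewrite /areg => lt_a lt_b E; split; lia. Qed.

Lemma update_code_ok (a : nat) (i e : expr) (s : store) (cf : config) :
  a < 14 -> wf_expr i -> wf_expr e -> represents s cf ->
  represents (seta s a (eval s i) (eval s e)) (execs cf (update_code a i e)).
Proof.
move=> lt_a wf_i wf_e Hs; have [E1 F1] := ecode_ok 0 wf_i Hs.
rewrite /update_code !foldl_cat; move: E1 F1; set cf1 := execs cf _ => E1 F1.
have [E2 F2] := address_ok 0 a cf1; move: E2 F2; set cf2 := execs cf1 _ => E2 F2.
have F := same_from_trans (leqnn 0) F1 F2.
have [E3 F3] := ecode_ok 1 wf_e (same_from_represents F Hs).
move: E3 F3; set cf3 := execs cf2 _ => E3 F3.
have E4 : regs cf3 (tmp 0) = regs cf2 (tmp 0).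
  by case: F3 => -> // u; rewrite /tmp; lia.
have := same_from_represents (same_from_trans (leqnSn 0) F F3) Hs.
move: E3 E4; case: (cf3) => pc X w /= E3 E4 [/= Hv Ha Hw].
split=> //= [y|b j lt_b]; rewrite E3 E4 E2 E1.
  by rewrite eqn_false ?Hv // /areg /vreg; lia.
case: (eqVneq b a) => [->|neq_ba] /=; last first.
  rewrite eqn_false ?Ha // => /areg_inj[]// eq_ba _.
  by rewrite eq_ba eqxx in neq_ba.
case: (eqVneq j (eval s i)) => [->|neq_ji] /=; first by rewrite eqxx.
rewrite eqn_false ?Ha // => /areg_inj[]// _ eq_ji.
by rewrite eq_ji eqxx in neq_ji.
Qed.

Lemma straight_assign (x : nat) (e : expr) : all straight (assign_code x e).
Proof. by rewrite /assign_code all_cat straight_ecode. Qed.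

Lemma straight_update (a : nat) (i e : expr) : all straight (update_code a i e).
Proof. by rewrite /update_code !all_cat !straight_ecode. Qed.

Definition reaches (P : program) (t : nat) (cf : config) (s : store) (pc : nat)
    : Prop :=
  exists t' cf', [/\ t' <= t, represents s cf', counter cf' = pc &
    forall u, run P (t' + u) cf = run P u cf'].

Lemma reaches_trans (P : program) (t1 t2 : nat) (cf : config) (s1 s2 : store)
    (pc1 pc2 : nat) :
  reaches P t1 cf s1 pc1 ->
  (forall cf1, represents s1 cf1 -> counter cf1 = pc1 ->
    reaches P t2 cf1 s2 pc2) ->
  reaches P (t1 + t2) cf s2 pc2.
Proof.
case=> t1' [cf1 [le1 Hs1 Hpc1 run1]] /(_ cf1 Hs1 Hpc1).
case=> t2' [cf2 [le2 Hs2 Hpc2 run2]].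
exists (t1' + t2'), cf2; split=> //; first by rewrite leq_add.
by move=> u; rewrite -addnA run1 run2.
Qed.

Lemma reaches_le (P : program) (t t' : nat) (cf : config) (s : store) (pc : nat) :
  t <= t' -> reaches P t cf s pc -> reaches P t' cf s pc.
Proof.
move=> le_tt' [t1 [cf1 [le1 Hs1 Hpc1 run1]]].
by exists t1, cf1; split=> //; apply: leq_trans le_tt'.
Qed.

Lemma reaches_straight (P : program) (code : seq instr) (cf : config) (s : store) :
  all straight code -> code_at P (counter cf) code ->
  represents s (execs cf code) ->
  reaches P (size code) cf s (counter cf + size code).
Proof.
move=> st Hc Hs; exists (size code), (execs cf code).
have [_ Hpc] := run_straight 0 st Hc.
by split=> // u; have [] := run_straight u st Hc.
Qed.

Lemma reaches_jump (P : program) (r l pc : nat) (s : store) (cf : config) :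
  code_at P (counter cf) [:: Jump r l] -> represents s cf ->
  pc = (if 0 < regs cf r then l else (counter cf).+1) ->
  reaches P 1 cf s pc.
Proof.
move=> /(_ 0 isT); rewrite addn0 => Hi [Hv Ha Hw] ->.
exists 1, (exec (Jump r l) cf); split=> //.
- by case: cf Hi Hv Ha Hw => pc' X w /= _ Hv Ha Hw; split.
- by case: cf {Hi Hv Ha Hw}.
by move=> u; rewrite add1n /= Hi.
Qed.

(** One unit of cost pays for at most [K] instructions: the straight code of an assignment or
    update, the evaluation of a loop bound plus 3 instructions on entry, or the 3 instructions of
    overhead in each round. *)
Lemma ccode_ok (P : program) (K pc : nat) (c : cmd) (s : store) (cf : config) :
  csize c <= K -> wf_cmd c -> code_at P pc (ccode pc c) -> counter cf = pc ->
  represents s cf -> reaches P (K * cost c s) cf (den c s) (pc + csize c).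
Proof.
elim: c pc s cf => [x e|a i e|x|c1 IH1 c2 IH2|x e c IH] pc s cf /=.
- move=> le_K wf_e Hc Hpc Hs; rewrite muln1; apply: reaches_le le_K _.
  rewrite -Hpc in Hc *; apply: reaches_straight => //; first exact: straight_assign.
  exact: assign_code_ok.
- move=> le_K /and3P[lt_a wf_i wf_e] Hc Hpc Hs; rewrite muln1; apply: reaches_le le_K _.
  rewrite -Hpc in Hc *; apply: reaches_straight => //; first exact: straight_update.
  exact: update_code_ok.
- move=> le_K _ Hc Hpc Hs; rewrite muln1; apply: reaches_le le_K _.
  rewrite -Hpc in Hc *; apply: (@reaches_straight _ [:: Read (vreg x)]) => //.
  case: cf Hs {Hc Hpc} => pc' X w [/= Hv Ha Hw]; split=> //= [y|a i lt_a|].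
  + by rewrite {1}/vreg {1}/vreg eqn_add2r eqn_mul2l /= Hv Hw.
  + by rewrite eqn_false ?Ha // /areg /vreg; lia.
  by rewrite Hw.
- move=> le_K /andP[wf1 wf2] /code_at_cat[]; rewrite size_ccode => Hc1 Hc2 Hpc Hs.
  rewrite mulnDr addnA; apply: reaches_trans (IH1 _ _ _ _ wf1 Hc1 Hpc Hs) _; first lia.
  by move=> cf1 Hs1 Hpc1; apply: IH2 => //; lia.
move=> le_K /and3P[wf_e x_c wf_c].
set l := pc + _ + 2; set n := eval s e.
case/code_at_cat=> Hc1 /(@code_at_cat _ _ [:: _; _])[Hc2].
case/(@code_at_cat _ _ [:: _; _])=> Hc3 /code_at_cat[].
rewrite size_ccode => Hc4 Hc5 Hpc Hs.
have {}Hc3 : code_at P l [:: Const (tmp 0) 1; Monus (vreg x) (vreg x) (tmp 0)] := Hc3.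
have {}Hc4 : code_at P (l + 2) (ccode (l + 2) c) := Hc4.
have {}Hc5 : code_at P (l + 2 + csize c) [:: Jump (vreg x) l] := Hc5.
set s0 := setv s x n.
have start : reaches P (size (assign_code x e) + 3) cf s0
    (if n is _.+1 then l else l + csize c + 3).
  apply: (@reaches_trans _ _ 3 _ s0 s0 (pc + size (assign_code x e))).
    rewrite -Hpc in Hc1 *; apply: reaches_straight => //; first exact: straight_assign.
    exact: assign_code_ok.
  move=> cf1 Hs1 Hpc1; rewrite -Hpc1 in Hc2.
  case/(@code_at_cat _ _ [:: _]): Hc2 => Hc21 Hc22.
  exists 3, (exec (Jump (vreg x) l)
    (exec (Jump (tmp 0) (l + 2 + csize c)) (exec (Const (tmp 0) 1) cf1))).
  have /(_ 0 isT) := Hc21; have /(_ 0 isT) := Hc22; rewrite /= !addn0 => J1 J0.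
  have /(_ 0 isT) := Hc5; rewrite /= addn0 => J2.
  case: cf1 Hs1 Hpc1 J0 J1 {Hc21 Hc22} => pc1 X w [/= Hv Ha Hw] Hpc1 J0 J1.
  have Ex : X (vreg x) = n by rewrite Hv eqxx.
  have Nx : (vreg x == tmp 0) = false by apply: eqn_false; rewrite /vreg /tmp; lia.
  split=> //=.
  + split=> //= [y|a i lt_a].
      by rewrite eqn_false ?Hv // /vreg /tmp; lia.
    by rewrite eqn_false ?Ha // /areg /tmp; lia.
  + by rewrite Nx Ex /=; case: (n) => //=; lia.
  by rewrite addn1 /= in J1; move=> u; rewrite J0 /= J1 /= J2.
have iter k s1 cf1 : represents s1 cf1 -> var s1 x = k ->
    counter cf1 = (if k is _.+1 then l else l + csize c + 3) ->
    reaches P (K * countdown_cost x (den c) (cost c) k s1) cf1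
      (countdown x (den c) k s1) (l + csize c + 3).
  elim: k s1 cf1 => [|k IHk] s1 cf1 Hs1 Ex Hpc1.
    by rewrite muln0; exists 0, cf1; split.
  rewrite /= mulnS mulnDr.
  set s2 := setv s1 x k.
  have Hk : reaches P 2 cf1 s2 (l + 2).
    rewrite -Hpc1 in Hc3 *.
    apply: (@reaches_straight _
      [:: Const (tmp 0) 1; Monus (vreg x) (vreg x) (tmp 0)]) => //.
    case: cf1 Hs1 {Hpc1 Hc3} => pc1 X w [/= Hv Ha Hw].
    have Nx y : (vreg y == tmp 0) = false by apply: eqn_false; rewrite /vreg /tmp; lia.
    split=> //= [y|a i lt_a].
      rewrite !Nx {1}/vreg {1}/vreg eqn_add2r eqn_mul2l /= !Hv Ex.
      by case: eqP => // _; lia.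
    have [-> ->] : (areg a i == vreg x) = false /\ (areg a i == tmp 0) = false.
      by split; apply: eqn_false; rewrite /areg /vreg /tmp; lia.
    exact: Ha.
  have Hb : reaches P (2 + K * cost c s2) cf1 (den c s2) (l + 2 + csize c).
    apply: reaches_trans Hk _ => cf2 Hs2 Hpc2.
    by apply: IH => //; lia.
  (* The closing jump tests the register that the body received, which is where [x \notin wvars c]
     enters. *)
  have Ex2 : var (den c s2) x = k by rewrite frame_var //= eqxx.
  have Hj : reaches P (2 + K * cost c s2 + 1) cf1 (den c s2)
      (if k is _.+1 then l else l + csize c + 3).
    apply: reaches_trans Hb _ => cf2 Hs2 Hpc2.
    apply: (@reaches_jump _ (vreg x) l) => //; first by rewrite Hpc2.
    by have [-> _ _] := Hs2; rewrite Ex2 Hpc2; case: (k) => //=; lia.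
  apply: (@reaches_le _ (2 + K * cost c s2 + 1 +
    K * countdown_cost x (den c) (cost c) k (den c s2))); first lia.
  by apply: reaches_trans Hj _ => cf2 Hs2 Hpc2; apply: IHk.
have -> : pc + (size (assign_code x e) + csize c + 5) = l + csize c + 3.
  by rewrite /l; lia.
rewrite mulnS; apply: (@reaches_le _ (size (assign_code x e) + 3 + K * _)); last first.
  apply: reaches_trans start _ => cf1 Hs1 Hpc1; apply: iter => //=.
  by rewrite eqxx.
by lia.
Qed.

Definition compile (c : cmd) (x : nat) : program :=
  ccode 0 c ++ [:: Jump (vreg x) (csize c + 2); Reject; Accept].

Definition start (w : seq nat) : store := MkStore (fun _ => 0) (fun _ _ => 0) w.

Lemma run_le (P : program) (t t' : nat) (cf : config) (b : bool) :
  t <= t' -> run P t cf = Some b -> run P t' cf = Some b.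
Proof.
elim: t t' cf => [|t IH] [|t'] cf //= le_tt'.
by case: (onth P _) => // -[] *; first [done | exact: IH | apply: IH; eassumption].
Qed.

Lemma compile_ok (c : cmd) (x : nat) (w : seq nat) (t : nat) :
  wf_cmd c -> cost c (start w) <= t ->
  run (compile c x) (csize c * t + 2) (init w)
    = Some (0 < var (den c (start w)) x).
Proof.
move=> wf_c le_t.
have [Hc He] : code_at (compile c x) 0 (ccode 0 c) /\
    code_at (compile c x) (csize c) [:: Jump (vreg x) (csize c + 2); Reject; Accept].
  have := @code_at_cat (compile c x) 0 (ccode 0 c) _ (fun k _ => erefl).
  by rewrite size_ccode add0n.
have [//|t' [cf [le_t' [Hv _ _] Hpc Hrun]]] :=
  @ccode_ok (compile c x) (csize c) 0 c (start w) (init w) (leqnn _) wf_c Hc erefl _.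
apply: (@run_le _ (t' + 2)).
  by rewrite leq_add2r (leq_trans le_t') // leq_mul2l le_t orbT.
have := He 0 isT; have := He 1 isT; have := He 2 isT; rewrite addn0 => E2 E1 E0.
rewrite Hrun /= Hpc add0n E0; case: cf Hv Hpc {Hrun} => pc X w' /= Hv Hpc.
rewrite Hv; case: ifP => _; first by rewrite E2.
by rewrite Hpc add0n -addn1 E1.
Qed.

(** * Program logic *)

Definition same (c : cmd) (s s' : store) : Prop :=
  (forall x, x \notin wvars c -> var s' x = var s x) /\
  (forall a, a \notin warrs c -> arr s' a = arr s a).

(** A Hoare triple for total correctness with a time bound, anchored at one initial store;
    termination is built into [den]. *)
Definition runs (c : cmd) (s : store) (t : nat) (Q : store -> Prop) : Prop :=
  cost c s <= t /\ Q (den c s).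

Lemma same_den (c : cmd) (s : store) : same c s (den c s).
Proof. by split=> ? ?; [apply: frame_var | apply: frame_arr]. Qed.

Lemma runs_weaken (c : cmd) (s : store) (t t' : nat) (Q Q' : store -> Prop) :
  runs c s t Q -> t <= t' -> (forall s', same c s s' -> Q s' -> Q' s') ->
  runs c s t' Q'.
Proof.
case=> le_t Qs le_tt' QQ'; split; first exact: leq_trans le_tt'.
by apply: QQ' => //; apply: same_den.
Qed.

Lemma runs_le (c : cmd) (s : store) (t t' : nat) (Q : store -> Prop) :
  runs c s t Q -> t <= t' -> runs c s t' Q.
Proof. by move=> H le_tt'; apply: runs_weaken H le_tt' _. Qed.

Lemma runs_assign (x : nat) (e : expr) (s : store) (t : nat) (Q : store -> Prop) :
  Q (setv s x (eval s e)) -> runs (Assign x e) s t.+1 Q.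
Proof. by []. Qed.

Lemma runs_update (a : nat) (i e : expr) (s : store) (t : nat)
    (Q : store -> Prop) :
  Q (seta s a (eval s i) (eval s e)) -> runs (Update a i e) s t.+1 Q.
Proof. by []. Qed.

Lemma runs_assign_then (x : nat) (e : expr) (c : cmd) (s : store) (t : nat)
    (Q : store -> Prop) :
  runs c (setv s x (eval s e)) t Q -> runs (Then (Assign x e) c) s t.+1 Q.
Proof. by case=> le_t Qs; split=> //=; rewrite add1n. Qed.

Lemma runs_update_then (a : nat) (i e : expr) (c : cmd) (s : store) (t : nat)
    (Q : store -> Prop) :
  runs c (seta s a (eval s i) (eval s e)) t Q ->
  runs (Then (Update a i e) c) s t.+1 Q.
Proof. by case=> le_t Qs; split=> //=; rewrite add1n. Qed.

Lemma runs_input_then (x : nat) (c : cmd) (s : store) (t : nat)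
    (Q : store -> Prop) :
  runs c (popv s x) t Q -> runs (Then (Input x) c) s t.+1 Q.
Proof. by case=> le_t Qs; split=> //=; rewrite add1n. Qed.

Lemma runs_then (c1 c2 : cmd) (s : store) (t1 t2 : nat) (Q1 Q : store -> Prop) :
  runs c1 s t1 Q1 ->
  (forall s1, same c1 s s1 -> Q1 s1 -> runs c2 s1 t2 Q) ->
  runs (Then c1 c2) s (t1 + t2) Q.
Proof.
case=> le1 Q1s /(_ _ (same_den c1 s) Q1s)[le2 Qs].
by split=> //=; apply: leq_add.
Qed.

(** The invariant is indexed by the number of rounds left. The relation [same] to the initial store
    is supplied at every round, so invariants need not mention what the body never writes. *)
Lemma runs_for (x : nat) (e : expr) (c : cmd) (s : store) (b : nat)
    (I : nat -> store -> Prop) :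
  I (eval s e) (setv s x (eval s e)) ->
  (forall k s', k < eval s e -> same (For x e c) s s' -> I k.+1 s' ->
    runs c (setv s' x k) b (I k)) ->
  runs (For x e c) s (eval s e * b.+1).+1 (I 0).
Proof.
rewrite /runs /=; set s0 := setv s x _.
have: same (For x e c) s s0.
  by split=> //= y; rewrite inE negb_or => /andP[/negPf-> _].
elim: (eval s e) s0 => [|k IH] s0 same0 I0 step //=.
have [le_b Ib] := step _ _ (ltnSn k) same0 I0.
have same1 : same (For x e c) s (den c (setv s0 x k)).
  have [fv fa] := same_den c (setv s0 x k); case: same0 => fv0 fa0.
  split=> [y /= y_c|a /= a_c]; last by rewrite fa ?fa0.
  move: (y_c); rewrite inE negb_or => /andP[/negPf yx yc].
  by rewrite fv //= yx fv0.
have [|le_t QI] := IH _ same1 Ib; last by split=> //; lia.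
by move=> j s' lt_jk; apply: step; apply: ltnW.
Qed.

Lemma runs_for_list (A : Type) (l : seq A) (x : nat) (e : expr) (c : cmd)
    (s : store) (b : nat) (I : seq A -> seq A -> store -> Prop) :
  eval s e = size l -> I [::] l (setv s x (size l)) ->
  (forall u a v s', l = u ++ a :: v -> same (For x e c) s s' ->
    I u (a :: v) s' -> runs c (setv s' x (size v)) b (I (rcons u a) v)) ->
  runs (For x e c) s (size l * b.+1).+1 (I l [::]).
Proof.
move=> El I0 step.
pose J k s' := exists u v, [/\ l = u ++ v, size v = k & I u v s'].
have: runs (For x e c) s (eval s e * b.+1).+1 (J 0).
  apply: runs_for => [|k s' _ same' [u [[|a v] [def_l //= [<-] Iuv]]]].
    by exists [::], l; rewrite El.
  have [le_b Ib] := step _ _ _ _ def_l same' Iuv.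
  by split=> //; exists (rcons u a), v; rewrite cat_rcons.
rewrite El; case=> le_t [u [v [def_l /size0nil v0 Iuv]]]; split=> //.
by move: Iuv; rewrite def_l v0 cats0.
Qed.

(** A loop whose bound is 0 or 1 serves as the conditional of the language. *)
Lemma runs_if (x : nat) (e : expr) (c : cmd) (s : store) (t : nat)
    (p : bool) (Q : store -> Prop) :
  eval s e = p :> nat ->
  (p -> runs c (setv (setv s x 1) x 0) t Q) -> (~~ p -> Q (setv s x 0)) ->
  runs (For x e c) s t.+2 Q.
Proof.
rewrite /runs /= => ->; case: p => /= [/(_ isT)[le_t Qs] _|_ /(_ isT) //].
by split=> //; lia.
Qed.

(** * The program *)

Declare Scope prog_scope.
Delimit Scope prog_scope with P.
Bind Scope prog_scope with expr.
Bind Scope prog_scope with cmd.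
Notation "e1 + e2" := (Sum e1 e2) : prog_scope.
Notation "e1 - e2" := (Diff e1 e2) : prog_scope.
Notation "a @[ e ]" := (Arr a e%P) (at level 2, format "a @[ e ]") : prog_scope.
Notation "x ::= e" := (Assign x e%P) (at level 70) : prog_scope.
Notation "c1 ;; c2" := (Then c1 c2) (at level 75, right associativity)
  : prog_scope.
Notation "'for' x < e 'do' c 'od'" := (For x e%P c%P)
  (at level 0, x at level 9, e at level 50, c at level 75) : prog_scope.
Coercion Cst : nat >-> expr.

(* The truth assignments of a stage are described by patterns of vN bits; a
   pattern is indexed by its value, which is below vM = 2 ^ vN, and vH is vM / 2.
   The literals of the current stage start at index vptr of aL. *)
Notation vN := 0 (only parsing).
Notation vM := 1 (only parsing).
Notation vH := 2 (only parsing).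
Notation vd := 3 (only parsing).
Notation vtau := 4 (only parsing).
Notation vptr := 5 (only parsing).
Notation vm := 6 (only parsing).
Notation vwide := 7 (only parsing).
Notation vs := 8 (only parsing).
Notation vcnt := 9 (only parsing).
Notation vp := 10 (only parsing).
Notation vq := 11 (only parsing).
Notation vb := 12 (only parsing).
Notation vi := 13 (only parsing).
Notation vj := 14 (only parsing).
Notation vok := 15 (only parsing).
Notation vt := 16 (only parsing).
Notation vc := 17 (only parsing).
Notation vn := 18 (only parsing).
Notation va := 19 (only parsing).
Notation vk := 20 (only parsing).
Notation vz := 21 (only parsing).
Notation vr := 22 (only parsing).

(* aL: two literals per clause, stored as code + 1, with 0 for a missing one;
   aC: number of clauses of each stage;
   aT: truth values of the literals stored in aL, so that aT[0] = 0;
   aX: variable of a literal stored in aL;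
   aV: variable that each bit of a pattern controls;
   aD: distance of each pattern to the patterns reachable so far;
   aE: copy of aD during a relaxation pass. *)
Notation aL := 0 (only parsing).
Notation aC := 1 (only parsing).
Notation aT := 2 (only parsing).
Notation aX := 3 (only parsing).
Notation aV := 4 (only parsing).
Notation aD := 5 (only parsing).
Notation aE := 6 (only parsing).

Definition read_clause : cmd :=
  (Input vz ;; va ::= 0 ;; vb ::= 0 ;;
   for vi < Var vz do vb ::= Var va ;; Input vq ;; va ::= Var vq + 1 od ;;
   Update aL (Var vptr) (Var va) ;;
   Update aL (Var vptr + 1) (Var vb) ;;
   vptr ::= Var vptr + 2)%P.

Definition read_formula : cmd :=
  (Input vcnt ;;
   Update aC (Var vs) (Var vcnt) ;;
   vs ::= Var vs + 1 ;;
   vm ::= Var vm + (Var vcnt - Var vm) ;;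
   for vj < Var vcnt do read_clause od)%P.

Definition read_input : cmd :=
  (Input vn ;; Input vd ;; Input vtau ;;
   for vt < Var vtau do read_formula od)%P.

(** Truncation makes [vwide] equal to 1 exactly when [4 * m <= d]. Setting only the odd cells of
    [aT], those of negated literals, records the all-false assignment. *)
Definition setup : cmd :=
  (vwide ::= 1 - (Var vm + Var vm + Var vm + Var vm - Var vd) ;;
   vN ::= Var vn ;;
   for vi < Var vwide do vN ::= Var vm + Var vm ;; vd ::= Var vN od ;;
   for vi < Var vn do
     Update aX (Var vi + Var vi + 1) (Var vi) ;;
     Update aX (Var vi + Var vi + 2) (Var vi) ;;
     Update aV (Var vi) (Var vi) ;;
     Update aT (Var vi + Var vi + 1) 1 od ;;
   vM ::= 1 ;;
   for vi < Var vN do vH ::= Var vM ;; vM ::= Var vM + Var vM od ;;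
   vptr ::= 0 ;;
   vs ::= 0)%P.

Definition fill : cmd :=
  for vi < Var vwide do
    for vj < Var vcnt + Var vcnt do
      Update aV (Var vj) aX@[aL@[Var vptr + Var vj]]
    od
  od%P.

(** The doubled value reaches [2 ^ N] exactly when the top bit is set, and that bit is then
    subtracted. Bits come in decreasing order of index, so among bits controlling the same variable
    the one of smallest index is written last. *)
Definition decode : cmd :=
  (vq ::= Var vp ;;
   for vi < Var vN do
     vq ::= Var vq + Var vq ;;
     vb ::= 1 - (Var vM - Var vq) ;;
     Update aT (aV@[Var vi] + aV@[Var vi] + 2) (Var vb) ;;
     Update aT (aV@[Var vi] + aV@[Var vi] + 1) (1 - Var vb) ;;
     for vc < Var vb do vq ::= Var vq - Var vM od
   od)%P.

Definition check : cmd :=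
  (vok ::= 1 ;;
   for vj < Var vcnt do
     vok ::= Var vok - (1 - (aT@[aL@[Var vptr + (Var vj + Var vj)]]
                             + aT@[aL@[Var vptr + (Var vj + Var vj) + 1]]))
   od)%P.

(** The cell of the pattern is read as its distance to the previous reachable set and overwritten in
    place as a seed for the next one. This is safe because marking a pattern looks at no other cell
    of [aD]. *)
Definition mark : cmd :=
  (decode ;; check ;;
   vok ::= Var vok - (aD@[Var vp] - Var vd) ;;
   Update aD (Var vp) 0 ;;
   for vi < 1 - Var vok do Update aD (Var vp) (Var vN + 1) od)%P.

Definition emin (e1 e2 : expr) : expr := (e1 - (e1 - e2))%P.

Definition relax : cmd :=
  (for vi < Var vH do
     Update aE (Var vi + Var vi) (emin aD@[Var vi] (aD@[Var vi + Var vH] + 1)) ;;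
     Update aE (Var vi + Var vi + 1) (emin aD@[Var vi + Var vH] (aD@[Var vi] + 1)) od ;;
   for vi < Var vM do Update aD (Var vi) aE@[Var vi] od)%P.

Definition stage : cmd :=
  (vcnt ::= aC@[Var vs] ;;
   vs ::= Var vs + 1 ;;
   fill ;;
   for vp < Var vM do mark od ;;
   vptr ::= Var vptr + (Var vcnt + Var vcnt) ;;
   for vk < Var vN do relax od)%P.

Definition solve : cmd :=
  (read_input ;; setup ;; for vt < Var vtau do stage od ;;
   vr ::= 1 - (aD@[0] - Var vN))%P.

Lemma wf_solve : wf_cmd solve.
Proof. by []. Qed.

(** * Reading the input *)

(** The fold mirrors the shifting of [va] into [vb] while a clause is read. Codes are raised by one
    to free 0 for a missing literal. *)
Definition clause_lits (n : nat) (c : clause n) : nat * nat :=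
  foldl (fun p l => ((encode_literal l).+1, p.1)) (0, 0) c.

Definition formula_lits (n : nat) (phi : formula n) : seq nat :=
  flatten [seq [:: (clause_lits c).1; (clause_lits c).2] | c <- phi].

Definition holds (s : store) (a o : nat) (l : seq nat) : Prop :=
  forall i, i < size l -> arr s a (o + i) = nth 0 l i.

Lemma size_formula_lits (n : nat) (phi : formula n) :
  size (formula_lits phi) = (size phi).*2.
Proof. by elim: phi => //= c phi IH; rewrite /formula_lits /= IH. Qed.

Lemma holds_cat (s : store) (a o : nat) (l1 l2 : seq nat) :
  holds s a o (l1 ++ l2) <-> holds s a o l1 /\ holds s a (o + size l1) l2.
Proof.
split=> [H|[H1 H2] i].
  split=> i lt_i; last first.
    by rewrite -addnA H ?size_cat ?ltn_add2l // nth_cat ltnNge leq_addr /= addKn.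
  by rewrite H ?size_cat ?nth_cat ?lt_i // ltn_addr.
rewrite size_cat nth_cat; case: (ltnP i (size l1)) => [lt_i _|le_i lt_i]; first exact: H1.
by rewrite -H2 -?addnA ?subnKC //; lia.
Qed.

Lemma read_clause_ok (n : nat) (c : clause n) (l w : seq nat) (s : store) :
  stream s = encode_clause c ++ w -> holds s aL 0 l -> var s vptr = size l ->
  runs read_clause s 15 (fun s' => [/\ stream s' = w,
    holds s' aL 0 (l ++ [:: (clause_lits c).1; (clause_lits c).2]) &
    var s' vptr = (size l).+2]).
Proof.
move=> Hw Hl Hptr; rewrite /read_clause.
apply: runs_input_then; apply: runs_assign_then; apply: runs_assign_then.
rewrite /popv Hw /=.
set s0 := (X in runs _ X); set code := (X in Then X _).
pose I (u v : seq (literal n)) s' := stream s' = [seq encode_literal l | l <- v] ++ w /\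
   (var s' va, var s' vb) =
   foldl (fun p l => ((encode_literal l).+1, p.1)) (0, 0) u.
apply: (@runs_le _ _ (9 + 3)) => //.
apply: (@runs_then _ _ _ _ _ (I c [::])).
  have H : runs code s0 ((size c * 4).+1) (I c [::]).
    apply: runs_for_list => // u x v s' def_c _ [Es Eab].
    apply: runs_assign_then; apply: runs_input_then; apply: runs_assign.
    rewrite /I /= Es /=; split=> //.
    by rewrite foldl_rcons -Eab /= addn1.
  by apply: runs_weaken H _ _ => //; have := size_bseq c; lia.
move=> s1 [fv fa] [Es Eab].
apply: runs_update_then; apply: runs_update_then; apply: runs_assign => /=.
have Eptr : var s1 vptr = size l by rewrite fv.
have EL : arr s1 aL = arr s aL by rewrite fa.
rewrite Eptr; split=> //; last by rewrite addn2.
apply/holds_cat; split=> [i lt_i|[|[|i]]] //=; rewrite add0n ?EL.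
- have [-> ->] : (i == size l + 1) = false /\ (i == size l) = false by lia.
  exact: Hl.
- by rewrite addn0 eqxx ifF; [rewrite /clause_lits -Eab | lia].
by rewrite eqxx /clause_lits -Eab.
Qed.

Lemma read_formula_ok (n : nat) (phi : formula n) (l lc w : seq nat)
    (s : store) :
  stream s = encode_formula phi ++ w ->
  holds s aL 0 l -> var s vptr = size l ->
  holds s aC 0 lc -> var s vs = size lc ->
  runs read_formula s (5 + size phi * 16) (fun s' =>
    [/\ stream s' = w,
        holds s' aL 0 (l ++ formula_lits phi) /\
        var s' vptr = size (l ++ formula_lits phi),
        holds s' aC 0 (rcons lc (size phi)) /\
        var s' vs = size (rcons lc (size phi)) &
        var s' vm = maxn (var s vm) (size phi)]).
Proof.
move=> Hw Hl Hptr Hc Hs; rewrite /read_formula.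
rewrite -[_ + _]/((size phi * 16).+1.+4).
apply: runs_input_then; apply: runs_update_then; do 2!apply: runs_assign_then.
rewrite /popv Hw /=; set s0 := (X in runs _ X).
pose I (u v : formula n) s' := [/\
  stream s' = flatten [seq encode_clause c | c <- v] ++ w,
  holds s' aL 0 (l ++ formula_lits u) &
  var s' vptr = size (l ++ formula_lits u)].
have H : runs (For vj (Var vcnt) read_clause) s0 (size phi * 16).+1 (I phi [::]).
  apply: runs_for_list => //; first by split=> //=; rewrite cats0.
  move=> u c v s' _ _ [/= Es El Eptr].
  apply: runs_weaken (@read_clause_ok n c (l ++ formula_lits u) _ _ _ _ _) _ _;
    rewrite //= ?Es -?catA //.
  move=> s2 _ [Es2 El2 Eptr2].
  have E : formula_lits (rcons u c)
    = formula_lits u ++ [:: (clause_lits c).1; (clause_lits c).2].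
    by rewrite /formula_lits map_rcons -cats1 flatten_cat.
  by split; rewrite // E // Eptr2 !size_cat addnA addn2.
apply: runs_weaken H _ _ => // s1 [fv fa] [Es1 El1 Eptr1]; split=> //.
  rewrite fv //= size_rcons Hs addn1; split=> // i.
  rewrite size_rcons ltnS leq_eqVlt fa //= nth_rcons add0n Hs.
  by case: (ltngtP i (size lc)) => //= lt_i _; exact: Hc.
by rewrite fv //= maxnE.
Qed.

Lemma read_input_ok (n d m : nat) (phis : seq (formula n)) :
  (forall phi, phi \in phis -> size phi <= m) ->
  runs read_input
    (start [:: n, d, size phis & flatten [seq encode_formula phi | phi <- phis]])
    (4 + size phis * (6 + m * 16))
    (fun s => [/\ var s vn = n /\ var s vd = d, var s vtau = size phis,
      var s vm = \max_(phi <- phis) size phi,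
      holds s aL 0 (flatten [seq formula_lits phi | phi <- phis]) &
      holds s aC 0 [seq size phi | phi <- phis]]).
Proof.
move=> le_m; rewrite /read_input; set t := size phis * _.
rewrite -[4 + t]/(t.+1.+3); do 3!apply: runs_input_then; rewrite /popv /=.
set s0 := (X in runs _ X).
pose I (u v : seq (formula n)) s :=
  [/\ stream s = flatten [seq encode_formula phi | phi <- v],
      holds s aL 0 (flatten [seq formula_lits phi | phi <- u]) /\
      var s vptr = size (flatten [seq formula_lits phi | phi <- u]),
      holds s aC 0 [seq size phi | phi <- u] /\ var s vs = size u &
      var s vm = \max_(phi <- u) size phi].
have H : runs (For vt (Var vtau) read_formula) s0 t.+1 (I phis [::]).
  apply: runs_for_list => //; first by split; rewrite ?big_nil.
  move=> u phi v s' def_phis _ [/= Es [El Eptr] [Ec Evs] Em].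
  apply: runs_weaken (@read_formula_ok n phi _ _ _ (setv s' vt (size v))
    Es El Eptr Ec _) _ _.
  - by rewrite size_map.
  - have: size phi <= m by apply: le_m; rewrite def_phis mem_cat mem_head orbT.
    by lia.
  move=> s2 _ [Es2 El2 [Ec2 Evs2] Em2]; split=> //.
  - by rewrite map_rcons -cats1 flatten_cat /= cats0.
  - by rewrite map_rcons; rewrite !size_rcons size_map in Evs2 *.
  by rewrite -cats1 big_cat big_seq1 Em2 /= Em.
apply: runs_weaken H _ _ => // s1 [fv fa] [_ [El _] [Ec _] Em]; split=> //.
- by rewrite !fv.
by rewrite fv.
Qed.

(** * Truth tables and initialization *)

(** The table is indexed by stored literals rather than variables, so a clause is tested by two
    lookups; cell 0 makes a missing literal false. *)
Definition tabulates (n : nat) (s : store) (f : nat -> bool) : Prop :=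
  arr s aT 0 = 0 /\
  forall x (b : bool), x < n -> arr s aT (x.*2 + b).+1 = (f x == b).

(* In the wide case [4m <= d] consecutive stages do not interact: there the
   patterns range over the occurrences of the variables in a stage, and the
   distance bound is void. *)
Definition wide (m d : nat) : bool := 4 * m <= d.
Definition width (n m d : nat) : nat := if wide m d then 2 * m else n.
Definition radius (n m d : nat) : nat := if wide m d then 2 * m else d.

(** For width 0 the doubling loop does not set [vH], but then no relaxation pass reads it either. *)
Definition ready (n m d : nat) (s : store) : Prop :=
  [/\ var s vwide = wide m d, var s vN = width n m d,
      var s vd = radius n m d, var s vM = 2 ^ width n m d &
      0 < width n m d -> var s vH = 2 ^ (width n m d).-1].

(** Index 0, the missing literal, is sent to variable 0; in the wide case this merely gives that
    variable one more controlling bit. *)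
Definition var_table (n : nat) (s : store) : Prop :=
  forall l, l <= n.*2 -> arr s aX l = l.-1./2.

Lemma setup_ok (n m d : nat) (s : store) :
  var s vn = n -> var s vd = d -> var s vm = m ->
  (forall i, arr s aT i = 0) -> arr s aX 0 = 0 ->
  runs setup s (11 + n * 5 + width n m d * 3) (fun s' =>
    [/\ ready n m d s', var s' vptr = 0 /\ var s' vs = 0,
        var_table n s', tabulates n s' xpred0 &
        forall i, i < n -> arr s' aV i = i]).
Proof.
move=> En Ed Em ET EX0; rewrite /setup; set N := width n m d.
apply: (@runs_le _ _ (4 + ((n * 5).+1 + ((N * 3).+1 + 2).+1)).+2); last lia.
do 2!apply: runs_assign_then; set s0 := (X in runs _ X).
apply: (@runs_then _ _ _ 4 _ (fun s1 => [/\ var s1 vwide = wide m d,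
   var s1 vN = N & var s1 vd = radius n m d])).
  apply: (@runs_if _ _ _ _ _ (wide m d)); rewrite /N /radius /width.
  - by rewrite /= Em Ed /wide; case: leqP => /=; lia.
  - move=> w; apply: runs_assign_then; apply: runs_assign.
    by rewrite /= Em Ed w; move: w; rewrite /wide; split=> //; lia.
  by move=> w; rewrite (negPf w) /= En Ed Em; move: w; rewrite /wide; split=> //; lia.

move=> s1 [fv fa] [Ew1 EN1 Ed1].
have En1 : var s1 vn = n by rewrite fv.
have ET1 i : arr s1 aT i = 0 by rewrite fa ?ET.
pose I k s' := [/\
  arr s' aX 0 = 0 /\
    forall x (b : bool), k <= x < n -> arr s' aX (x.*2 + b).+1 = x,
  forall x, k <= x < n -> arr s' aV x = x,
  forall x, arr s' aT x.*2 = 0 &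
  forall x, arr s' aT (x.*2).+1 = (k <= x < n)].
apply: (@runs_then _ _ _ _ _ (I 0)).
  rewrite -[in (n * 5).+1]En1 -[var s1 vn]/(eval s1 (Var vn)).
  apply: runs_for => /=; rewrite En1.
    split=> [|x|x|x] /=; [by split=> [|x b]; rewrite ?fa //; lia|lia|by rewrite ET1|].
    by rewrite ET1; case: andP => //; lia.
  move=> k s2 lt_kn _ [[EX1 EX] EV ET2 ET3].
  do 3!apply: runs_update_then; apply: runs_update => /=.
  split=> [|x le_x|x|x] /=.
  - split=> [|x b le_x]; first by rewrite addn1 addn2.
    case: ifP => [/eqP|] ne2; first by case: b ne2; lia.
    case: ifP => [/eqP|] ne1; first by case: b ne2 ne1; lia.
    by apply: EX; case: b ne2 ne1; lia.
  - by case: eqP => // ne; apply: EV; lia.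
  - by rewrite ifF ?ET2 //; lia.
  by case: eqP => [|ne]; rewrite ?ET3; lia.
move=> s2 [fv2 fa2] [[EX1 EX2] EV2 ET2 ET3]; apply: runs_assign_then.
have EN2 : var s2 vN = N by rewrite fv2.
pose J k s' := var s' vM = 2 ^ (N - k) /\
  (k < N -> var s' vH = 2 ^ (N - k).-1).
apply: (@runs_then _ _ _ _ _ (J 0)).
  rewrite -[in (N * 3).+1]EN2 -[var s2 vN]/(eval (setv s2 vM 1) (Var vN)).
  apply: runs_for => /=; rewrite EN2.
    by rewrite /J subnn ltnn.
  move=> k s3 lt_kN _ [EM EH].
  apply: runs_assign_then; apply: runs_assign; rewrite /J /= EM subnS.
  by split=> //; rewrite addnn -mul2n -expnS prednK // subn_gt0.
move=> s3 [fv3 fa3] [EM3 EH3]; rewrite subn0 in EM3 EH3.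
apply: runs_assign_then; apply: runs_assign; split=> //.
- split=> //=; rewrite fv3 //= ?EN2 // ?fv2 //=.
- move=> [|l] le_l /=; rewrite fa3 //=.
  by rewrite -[in LHS](odd_double_half l) addnC EX2 //; lia.
- split=> [|x b lt_x] /=; rewrite fa3 //=; first exact: (ET2 0).
  case: b; rewrite ?addn0 ?addn1 ?ET3 ?lt_x //.
  by rewrite -doubleS ET2.
by move=> i lt_i /=; rewrite fa3 //= EV2.
Qed.

(** * Patterns *)

Fixpoint pval (q : seq bool) : nat :=
  if q is b :: q' then b * 2 ^ size q' + pval q' else 0.

Lemma pval_lt (q : seq bool) : pval q < 2 ^ size q.
Proof. by elim: q => //= b q IH; rewrite expnS; case: b; lia. Qed.

Lemma pval_inj (q q' : seq bool) : size q = size q' -> pval q = pval q' -> q = q'.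
Proof.
elim: q q' => [|b q IH] [|b' q'] //= [eq_sz].
have := pval_lt q; have := pval_lt q'; rewrite eq_sz => lt1 lt2 eq_val.
have eq_b : b = b' by case: b b' eq_val => [] [] //=; lia.
by rewrite eq_b (IH q') //; move: eq_val; rewrite eq_b; lia.
Qed.

Lemma pval_surj (N k : nat) : k < 2 ^ N -> exists2 q, size q = N & pval q = k.
Proof.
elim: N k => [|N IH] k; first by case: k => // _; exists [::].
rewrite expnS => lt_k; case: (ltnP k (2 ^ N)) => [/IH[q sq vq]|le_k].
  by exists (false :: q); rewrite /= ?sq.
have [|q sq vq] := IH (k - 2 ^ N); first lia.
by exists (true :: q); rewrite /= ?sq ?vq ?mul1n ?subnKC.
Qed.

Lemma pval_rcons (q : seq bool) (b : bool) : pval (rcons q b) = (pval q).*2 + b.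
Proof.
by elim: q => [|c q /= ->]; [case: b | rewrite size_rcons expnS; case: c; lia].
Qed.

(* Bit i of the pattern, counted from the end, is the value of variable V i;
   if V repeats a variable, the smallest index wins. *)
Fixpoint assign (V : nat -> nat) (q : seq bool) (f : nat -> bool) : nat -> bool :=
  if q is b :: q' then assign V q' [eta f with V (size q') |-> b] else f.

Lemma tabulates_set (n : nat) (s s' : store) (f : nat -> bool) (x : nat)
    (b : bool) :
  tabulates n s f ->
  (forall i, arr s' aT i =
     if i == x.*2.+1 then ~~ b : nat else if i == x.*2.+2 then b : nat
     else arr s aT i) ->
  tabulates n s' [eta f with x |-> b].
Proof.
move=> [T0 T1] E; split=> [|y c lt_y]; rewrite E //=.
case: (eqVneq y x) => [->|ne_yx].
  case: c; rewrite ?addn1 ?addn0 ?eqxx; last by case: (b).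
  by rewrite ifF ?eqxx; [case: (b) | lia].
have [-> ->] : ((y.*2 + c).+1 == x.*2.+1) = false /\
  ((y.*2 + c).+1 == x.*2.+2) = false by case: c; lia.
exact: T1.
Qed.

Lemma decode_ok (n N : nat) (q : seq bool) (f : nat -> bool) (s : store) :
  size q = N -> var s vN = N -> var s vM = 2 ^ N -> var s vp = pval q ->
  tabulates n s f ->
  runs decode s (2 + N * 8) (fun s' => tabulates n s' (assign (arr s aV) q f)).
Proof.
move=> sq EN EM Ep Tf; rewrite /decode -[2 + _]/((N * 8).+2).
apply: runs_assign_then; rewrite -[in (N * 8).+1]sq.
(* The bits [u] already read have been shifted out, so [vq] holds the rest [v] moved to the top.
   Writing [v] over the current table still leads to the intended assignment. *)
pose I (u v : seq bool) s' := var s' vq = 2 ^ size u * pval v /\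
  exists2 f', tabulates n s' f' & assign (arr s aV) v f' = assign (arr s aV) q f.
apply: runs_weaken (_ : runs _ _ (size q * 8).+1 (I q [::])) _ _ => //; last first.
  by move=> s' _ [_ [f' Tf' <-]].
apply: runs_for_list.
- by rewrite /= EN sq.
- by split; [rewrite /= Ep mul1n | exists f].
move=> u b v s1 def_q [fv fa] [Eq [f' Tf' Ef']].
have EN1 : N = size u + (size v).+1 by rewrite -sq def_q size_cat.
have EM1 : var s1 vM = 2 * (2 ^ size u * 2 ^ size v).
  by rewrite fv //= EM EN1 addnS expnS expnD.
have EV1 i : arr s1 aV i = arr s aV i by rewrite fa.
have lt_v : 2 ^ size u * pval v < 2 ^ size u * 2 ^ size v.
  by rewrite ltn_pmul2l ?expn_gt0 ?pval_lt.
rewrite /= mulnDr mulnCA in Eq.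
set s2 := setv (setv (setv s1 vi (size v)) vq (var s1 vq + var s1 vq)) vb b.
have Eb : 1 - (var s1 vM - (var s1 vq + var s1 vq)) = b.
  by rewrite EM1 Eq; case: (b); lia.
apply: runs_assign_then; apply: runs_assign_then; rewrite /= Eb -/s2.
do 2!apply: runs_update_then => /=.
apply: (@runs_if _ _ _ _ _ b) => //= [b1|b0].
  apply: runs_assign; split=> /=.
    by rewrite EM1 Eq b1 size_rcons expnS; lia.
  exists [eta f' with arr s aV (size v) |-> b] => //.
  apply: tabulates_set Tf' _ => i /=; rewrite EV1 addnn addn1 addn2 b1.
  by case: eqP.
split=> /=.
  by rewrite Eq (negPf b0) size_rcons expnS; lia.
exists [eta f' with arr s aV (size v) |-> b] => //.
apply: tabulates_set Tf' _ => i /=; rewrite EV1 addnn addn1 addn2 (negPf b0).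
by case: eqP.
Qed.

Definition restrict (n : nat) (f : nat -> bool) : assignment n :=
  [ffun i : 'I_n => f i].

Lemma sat_clause_table (n : nat) (s : store) (f : nat -> bool) (c : clause n) :
  tabulates n s f ->
  (0 < arr s aT (clause_lits c).1 + arr s aT (clause_lits c).2)
    = sat_clause (restrict n f) c.
Proof.
move=> [T0 T1].
have Tl (l : literal n) : arr s aT (encode_literal l).+1 = (restrict n f l.1 == l.2).
  by rewrite T1 // ffunE.
case: c => -[|l1 [|l2 [|l3 c]]] //= lt_c; rewrite /clause_lits /sat_clause /=.
- by rewrite T0.
- by rewrite Tl T0 addn0 lt0b orbF.
by rewrite !Tl addn_gt0 !lt0b orbF orbC.
Qed.

Lemma nth_formula_lits (n : nat) (phi : formula n) (c0 : clause n) (j : nat) :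
  j < size phi ->
  nth 0 (formula_lits phi) j.*2 = (clause_lits (nth c0 phi j)).1 /\
  nth 0 (formula_lits phi) j.*2.+1 = (clause_lits (nth c0 phi j)).2.
Proof. by elim: phi j => // c phi IH [|j] //= /IH. Qed.

Lemma check_ok (n : nat) (phi : formula n) (f : nat -> bool) (s : store) :
  tabulates n s f -> var s vcnt = size phi ->
  holds s aL (var s vptr) (formula_lits phi) ->
  runs check s (2 + size phi * 2)
    (fun s' => var s' vok = sat_formula (restrict n f) phi).
Proof.
move=> Tf Ec HL; rewrite /check -[2 + _]/((size phi * 2).+2).
apply: runs_assign_then.
pose I k s' := var s' vok = all (sat_clause (restrict n f)) (drop k phi).
apply: runs_weaken (_ : runs _ _ (size phi * 2).+1 (I 0)) _ _ => //; last first.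
  by move=> s' _; rewrite /I drop0.
rewrite -[in (size phi * 2).+1]Ec.
rewrite -[var s vcnt]/(eval (setv s vok 1) (Var vcnt)).
apply: runs_for => /=; rewrite Ec.
  by rewrite /I /= drop_oversize.
move=> k s1 lt_k [fv fa] Eok; apply: runs_assign => /=.
have c0 : clause n := [bseq].
have [E1 E2] := nth_formula_lits c0 lt_k.
have lt2 : k.*2.+1 < size (formula_lits phi) by rewrite size_formula_lits; lia.
have Eptr : var s1 vptr = var s vptr by rewrite fv.
rewrite /I /= (drop_nth c0) //= Eok Eptr !fa //= -addnA addn1 addnn.
rewrite HL ?E1 ?(ltnW lt2) // HL // E2.
rewrite -(sat_clause_table _ Tf).
by case: (_ + _) => [|j] //=; case: all.
Qed.

Lemma mark_ok (n N r : nat) (q : seq bool) (phi : formula n) (f : nat -> bool)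
    (s : store) :
  size q = N -> var s vN = N -> var s vM = 2 ^ N -> var s vp = pval q ->
  tabulates n s f -> var s vcnt = size phi ->
  holds s aL (var s vptr) (formula_lits phi) -> var s vd = r ->
  runs mark s (9 + N * 8 + size phi * 2) (fun s' =>
    tabulates n s' (assign (arr s aV) q f) /\
    forall i, arr s' aD i = if i == pval q then
      if sat_formula (restrict n (assign (arr s aV) q f)) phi
         && (arr s aD (pval q) <= r) then 0 else N.+1
      else arr s aD i).
Proof.
move=> sq EN EM Ep Tf Ec HL Ed; rewrite /mark.
apply: (@runs_le _ _ (2 + N * 8 + (2 + size phi * 2 + 5))); last lia.
apply: runs_then (decode_ok sq EN EM Ep Tf) _ => s1 [fv1 fa1].
set g := assign _ q f => Tg.
apply: (@runs_then _ _ _ _ _ (fun s' => var s' vok = sat_formula (restrict n g) phi)).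
  by apply: check_ok => //; rewrite ?fv1 // /holds fa1.
move=> s2 [fv2 fa2] Eok.
apply: runs_assign_then; apply: runs_update_then.
have Ep2 : var s2 vp = pval q by rewrite fv2 // fv1.
have EN2 : var s2 vN = N by rewrite fv2 // fv1.
have Ed2 : var s2 vd = r by rewrite fv2 // fv1.
have ED2 : arr s2 aD = arr s aD by rewrite fa2 // fa1.
set b := sat_formula _ _ in Eok *.
have E : var s2 vok - (arr s2 aD (var s2 vp) - var s2 vd)
    = b && (arr s aD (pval q) <= r).
  by rewrite Eok ED2 Ep2 Ed2; case: leqP => [|lt_r]; case: (b) => //=; lia.
rewrite /= E.
apply: (@runs_if _ _ _ _ _ (~~ (b && (arr s aD (pval q) <= r)))).
- by rewrite /=; case: (_ && _).
- move=> /negPf->; apply: runs_update => /=; split=> [|i] /=.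
    by move: Tg; rewrite /tabulates /= fa2.
  by rewrite Ep2 EN2 addn1 ED2; case: eqP.
move=> /negPn->; split=> [|i] /=; last by rewrite Ep2 ED2; case: eqP.
by move: Tg; rewrite /tabulates /= fa2.
Qed.

(** Each pattern is decoded on top of the table left by the one before. Acceptance is assumed
    independent of that table, so the invariant only needs some [f] to be tabulated. *)
Lemma mark_all_ok (n N r : nat) (phi : formula n) (okb : seq bool -> bool)
    (s : store) :
  var s vN = N -> var s vM = 2 ^ N -> var s vcnt = size phi ->
  holds s aL (var s vptr) (formula_lits phi) -> var s vd = r ->
  (forall q f, size q = N ->
    sat_formula (restrict n (assign (arr s aV) q f)) phi = okb q) ->
  (exists f, tabulates n s f) ->
  runs (For vp (Var vM) mark) s (1 + 2 ^ N * (10 + N * 8 + size phi * 2))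
    (fun s' => (exists f, tabulates n s' f) /\
      forall q, size q = N -> arr s' aD (pval q) =
        if okb q && (arr s aD (pval q) <= r) then 0 else N.+1).
Proof.
move=> EN EM Ec HL Ed ok [f0 Tf0].
pose I k s' := (exists f, tabulates n s' f) /\
  forall q, size q = N -> arr s' aD (pval q) =
    if k <= pval q then if okb q && (arr s aD (pval q) <= r) then 0 else N.+1
    else arr s aD (pval q).
rewrite add1n.
apply: runs_weaken
  (_ : runs _ _ (2 ^ N * (10 + N * 8 + size phi * 2)).+1 (I 0)) _ _ => //.
  rewrite -[in 2 ^ N * _]EM -[var s vM]/(eval s (Var vM)).
  apply: runs_for => /=; rewrite EM.
    by split=> [|q sq]; [exists f0 | rewrite leqNgt -sq pval_lt].
  move=> k s1 lt_k [fv fa] [[f Tf] EDs].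
  have [q sq vq] := pval_surj lt_k.
  apply: runs_weaken (@mark_ok n N r q phi f (setv s1 vp k) _ _ _ _ Tf _ _ _) _ _;
    rewrite //= ?fv //; first by rewrite /holds fa.
  move=> s2 _ [Tf2 /= ED2]; split=> [|q' sq']; first by eexists; exact: Tf2.
  rewrite ED2; case: eqP => [eq_v|ne]; last first.
    by rewrite EDs //; case: (ltngtP k (pval q')) => // eq_k; rewrite vq in ne; lia.
  have -> : q' = q by apply: pval_inj => //; rewrite sq.
  by rewrite fa // ok // EDs // vq ltnn leqnn.
Qed.

Lemma fill_ok (n : nat) (w : bool) (phi : formula n) (s : store) :
  var s vwide = w -> var s vcnt = size phi ->
  holds s aL (var s vptr) (formula_lits phi) ->
  runs fill s (3 + size phi * 4) (fun s' => forall i, arr s' aV i =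
    if w && (i < (size phi).*2) then arr s aX (nth 0 (formula_lits phi) i)
    else arr s aV i).
Proof.
move=> Ew Ec HL; rewrite /fill -[3 + _]/((size phi * 4).+3).
apply: (@runs_if _ _ _ _ _ w) => // w1; last by move=> i /=; rewrite (negPf w1).
rewrite w1 /=; set s1 := setv _ _ 0.
pose I k s' := forall i, arr s' aV i =
  if k <= i < (size phi).*2 then arr s aX (nth 0 (formula_lits phi) i)
  else arr s aV i.
apply: (@runs_le _ _ ((size phi).*2 * 2).+1); last lia.
have E : (size phi).*2 = eval s1 (Sum (Var vcnt) (Var vcnt)).
  by rewrite /= Ec addnn.
rewrite [in (_ * 2).+1]E; apply: (@runs_for _ _ _ _ _ I); rewrite -E.
  by move=> i /=; case: andP => //; lia.
move=> k s2 lt_k [fv fa] EI; apply: runs_update => i /=.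
rewrite EI fv //= !fa //= HL ?size_formula_lits //.
case: (eqVneq i k) => [->|ne] /=; first by rewrite leqnn lt_k.
by have -> : (k <= i) = (k < i) by lia.
Qed.

Lemma emin_minn (s : store) (e1 e2 : expr) :
  eval s (emin e1 e2) = minn (eval s e1) (eval s e2).
Proof. by rewrite /=; lia. Qed.

(* One pass consumes the first bit of the patterns and appends it again at the
   end, so that N passes restore the original indexing. *)
Lemma relax_ok (N : nat) (s : store) :
  var s vM = 2 ^ N.+1 -> var s vH = 2 ^ N ->
  runs relax s (2 + 2 ^ N.+1 * 5) (fun s' => forall q b, size q = N ->
    arr s' aD (pval (rcons q b))
      = minn (arr s aD (pval (b :: q))) (arr s aD (pval (~~ b :: q))).+1).
Proof.
move=> EM EH; rewrite /relax.
apply: (@runs_le _ _ ((2 ^ N * 3).+1 + (2 ^ N.+1 * 2).+1)); last by rewrite expnS; lia.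
pose v q b := minn (arr s aD (pval (b :: q))) (arr s aD (pval (~~ b :: q))).+1.
pose I k s' := forall q b, size q = N -> k <= pval q ->
  arr s' aE (pval (rcons q b)) = v q b.
apply: (@runs_then _ _ _ _ _ (I 0)).
  rewrite -[in 2 ^ N * 3]EH -[var s vH]/(eval s (Var vH)).
  apply: runs_for; rewrite /= EH.
    by move=> q b sq; rewrite leqNgt -sq pval_lt.
  move=> k s1 lt_k [fv fa] EI.
  apply: runs_update_then; apply: runs_update => q b sq le_k.
  rewrite pval_rcons !emin_minn /=.
  have ED1 : arr s1 aD = arr s aD by rewrite fa.
  rewrite fv //= EH !ED1 !addn1 addnn; set x := pval q.
  case: (eqVneq k x) => [Ek|ne].
    rewrite Ek /v /= sq -/x; case: b => /=; rewrite mul0n mul1n add0n.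
      by rewrite addn1 eqxx [x + _]addnC.
    by rewrite addn0 ifF ?eqxx ?[x + _]addnC //; lia.
  have [-> ->] : (x.*2 + b == k.*2.+1) = false /\ (x.*2 + b == k.*2) = false.
    by case: b; lia.
  by rewrite -pval_rcons EI //; lia.
move=> s1 [fv fa] EE.
have EM1 : 2 ^ N.+1 = eval s1 (Var vM) by rewrite /= fv.
pose J k s' := forall i, k <= i < 2 ^ N.+1 -> arr s' aD i = arr s1 aE i.
apply: runs_weaken (_ : runs _ _ (2 ^ N.+1 * 2).+1 (J 0)) _ _ => //.
  rewrite [in (_ * 2).+1]EM1; apply: runs_for; rewrite -EM1.
    by move=> i; lia.
  move=> k s2 lt_k [fv2 fa2] EJ; apply: runs_update => i le_i /=.
  by rewrite fa2 //; case: (eqVneq i k) => [->//|ne] /=; apply: EJ; lia.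
move=> s2 _ EJ q b sq; rewrite EJ ?EE //= -sq -(size_rcons q b).
exact: pval_lt.
Qed.

(** * Distances to the reachable patterns *)

Definition ham (u v : seq bool) : nat :=
  count (fun p => p.1 != p.2) (zip u v).

Lemma ham_rcons (u v : seq bool) (b c : bool) :
  size u = size v -> ham (rcons u b) (rcons v c) = ham u v + (b != c).
Proof. by move=> E; rewrite /ham zip_rcons // -cats1 count_cat /= addn0. Qed.

(** Hamming distance is a sum over coordinates, so the minimum over all [w] can be taken one bit at
    a time. Stating it through thresholds avoids a minimum over a set of sequences. *)
Lemma relax_all_ok (N : nat) (s : store) :
  var s vN = N -> var s vM = 2 ^ N -> (0 < N -> var s vH = 2 ^ N.-1) ->
  runs (For vk (Var vN) relax) s (1 + N * (3 + 2 ^ N * 5)) (fun s' =>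
    forall v e, size v = N -> arr s' aD (pval v) <= e <->
      exists w, size w = N /\ arr s aD (pval w) + ham w v <= e).
Proof.
move=> EN EM EH.
(* With [k] passes left, the first [N - k] bits have been minimized over and rotated to the end: the
   cell of [u ++ v] refers to original patterns [w ++ u], with [w] compared to [v]. *)
pose I k s' := forall u v e, size u = k -> size v = N - k ->
  arr s' aD (pval (u ++ v)) <= e <->
  exists w, size w = size v /\ arr s aD (pval (w ++ u)) + ham w v <= e.
rewrite add1n.
apply: runs_weaken (_ : runs _ _ (N * (3 + 2 ^ N * 5)).+1 (I 0)) _ _ => //; last first.
  move=> s' _ EI v e sv; rewrite (EI [::] v e) ?subn0 // sv.
  by split=> -[w [sw Hw]]; exists w; rewrite cats0 in Hw *.
rewrite -[in N * _]EN -[var s vN]/(eval s (Var vN)).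
apply: runs_for; rewrite /= EN.
  move=> u v e _; rewrite subnn => /size0nil->; rewrite cats0 /=.
  split=> [le_e|[w [/size0nil->]]]; last by rewrite /ham addn0.
  by exists [::]; rewrite /ham addn0.
move=> k s1 lt_k [fv fa] EI.
have EN1 : N = N.-1.+1 by lia.
apply: runs_weaken (@relax_ok N.-1 (setv s1 vk k) _ _) _ _.
- by rewrite /= fv // EM -EN1.
- by rewrite /= fv // EH //; lia.
- by rewrite -EN1.
move=> s2 _ ED u v' e su; case: (lastP v') => [|v b]; first by rewrite /=; lia.
rewrite size_rcons => sv; rewrite -rcons_cat ED; last by rewrite size_cat; lia.
have EIb c e' : arr s1 aD (pval (c :: u ++ v)) <= e' <->
    exists w, size w = size v /\ arr s aD (pval (rcons w c ++ u)) + ham w v <= e'.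
  rewrite -cat_cons EI /= ?su //; last by lia.
  by split=> -[w [sw Hw]]; exists w; rewrite cat_rcons in Hw *.
rewrite geq_min; split.
  case/orP=> [/EIb|lt_e].
    case=> w [sw Hw]; exists (rcons w b); rewrite size_rcons sw; split=> //.
    by rewrite ham_rcons // eqxx addn0.
  have {lt_e} : arr s1 aD (pval (~~ b :: u ++ v)) <= e.-1 /\ 0 < e.
    by move: lt_e => /=; lia.
  case=> /EIb[w [sw Hw]] e0; exists (rcons w (~~ b)); rewrite size_rcons sw; split=> //.
  by rewrite ham_rcons //; case: (b) Hw => /=; lia.
case=> w'; case: (lastP w') => [[]//|w c]; rewrite size_rcons => -[[sw]].
rewrite ham_rcons // => Hw; case: (eqVneq c b) Hw => [->|ne] /= Hw.
  by apply/orP; left; apply/EIb; exists w; rewrite addn0 in Hw.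
have Ec : c = ~~ b by case: (c) (b) ne => [] [].
apply/orP; right; have e0 : 0 < e by lia.
rewrite -(prednK e0) ltnS; apply/EIb; exists w; rewrite -Ec; split=> //.
by lia.
Qed.

(** * Acceptance of a pattern by a stage *)

(** An idealized content of [aV] that depends on the current stage only: past the last literal slot
    the default of [nth] gives variable 0, where the program may hold entries of earlier stages. *)
Definition pattern_var (n : nat) (w : bool) (phi : formula n) (i : nat) : nat :=
  if w then (nth 0 (formula_lits phi) i).-1./2 else i.

Definition good (n : nat) (w : bool) (phi : formula n) (q : seq bool) : bool :=
  sat_formula (restrict n (assign (pattern_var w phi) q xpred0)) phi.

(** The bit of smallest index that controls [y] decides its value. If one lies below [k], where [V]
    and [V'] agree about [y], then neither the bits from [k] on nor the base functions matter. *)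
Lemma assign_agree (V V' : nat -> nat) (k y : nat) (q : seq bool)
    (f f' : nat -> bool) :
  (forall i, i < k -> i < size q -> (V i == y) = (V' i == y)) ->
  (exists2 i, i < minn k (size q) & V i = y) \/ (f y = f' y /\ size q <= k) ->
  assign V q f y = assign V' q f' y.
Proof.
elim: q f f' => [|b q IH] f f' eqV /=.
  by case=> [[i]|[->]//]; rewrite minn0.
have eqV' i : i < k -> i < size q -> (V i == y) = (V' i == y).
  by move=> lt_ik lt_iq; apply: eqV => //=; apply: ltnW.
case=> [[i lt_i Vi]|[eq_f le_k]]; apply: IH => //=.
  case: (ltnP i (size q)) => [lt_iq|le_q].
    left; exists i => //; rewrite leq_min lt_iq.
    by move: lt_i; rewrite leq_min; case/andP=> ->.
  (* Here the controlling bit is the head itself: it writes the same value into both base functions,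
     which passes to the second alternative. *)
  have Ei : i = size q by lia.
  right; rewrite ![y == _]eq_sym -eqV /=; [|lia|lia].
  by rewrite -Ei Vi eqxx; split=> //; lia.
right; split; last exact: ltnW.
by rewrite ![y == _]eq_sym -eqV //= eq_f.
Qed.

Lemma eq_sat_formula (n : nat) (f f' : nat -> bool) (phi : formula n) :
  (forall c l, c \in phi -> l \in val c -> f l.1 = f' l.1) ->
  sat_formula (restrict n f) phi = sat_formula (restrict n f') phi.
Proof.
move=> eq_f; apply: eq_in_all => c phi_c; apply: eq_in_has => l c_l.
by rewrite !ffunE (eq_f c).
Qed.

Lemma mem_formula_lits (n : nat) (phi : formula n) (c : clause n)
    (l : literal n) :
  c \in phi -> l \in val c -> (encode_literal l).+1 \in formula_lits phi.
Proof.
move=> phi_c c_l; apply/flatten_mapP; exists c => //.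
case: c c_l {phi_c} => -[|l1 [|l2 [|l3 c]]] //= lt_c; rewrite !inE.
  by move/eqP->; rewrite eqxx.
by case/orP=> /eqP->; rewrite eqxx ?orbT.
Qed.

Lemma half_literal (n : nat) (l : literal n) : (encode_literal l)./2 = l.1.
Proof. by rewrite /encode_literal; case: l.2; lia. Qed.

(* In the wide case the pattern has a bit for every literal of the stage, so it
   fixes the value of every variable that the stage mentions. *)
Lemma sat_assign (n N : nat) (w : bool) (phi : formula n) (V : nat -> nat)
    (q : seq bool) (f : nat -> bool) :
  size q = N -> (if w then (size phi).*2 <= N else n <= N) ->
  (forall i, i < (if w then (size phi).*2 else n) -> V i = pattern_var w phi i) ->
  sat_formula (restrict n (assign V q f)) phi = good w phi q.
Proof.
move=> sq le_N eqV; apply: eq_sat_formula => c l phi_c c_l.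
apply: (@assign_agree _ _ (if w then (size phi).*2 else n)).
  by move=> i lt_i _; rewrite eqV.
left; case: w le_N eqV => le_N eqV.
  have := mem_formula_lits phi_c c_l => L.
  have lt_i := L; rewrite -index_mem size_formula_lits in lt_i.
  exists (index (encode_literal l).+1 (formula_lits phi)); first by rewrite sq; lia.
  by rewrite eqV // /pattern_var nth_index //= half_literal.
by exists l.1; [rewrite sq leq_min; have := ltn_ord l.1; lia | apply: eqV].
Qed.

Lemma formula_lits_le (n : nat) (phi : formula n) (i : nat) :
  nth 0 (formula_lits phi) i <= n.*2.
Proof.
have le_lit (l : literal n) : (encode_literal l).+1 <= n.*2.
  by have := ltn_ord l.1; rewrite /encode_literal; case: l.2; lia.
have : all (fun l => l <= n.*2) (formula_lits phi).
  elim: phi => //= -[[|l1 [|l2 [|l3 c]]] lt_c] phi IH //=; rewrite ?le_lit //=;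
  exact: IH.
move=> H; case: (ltnP i (size (formula_lits phi))) => [lt_i|le_i].
  by apply: (all_nthP 0 H).
by rewrite nth_default.
Qed.

(** The content of [aV] is fixed only in the narrow case; in the wide case [fill] rewrites a prefix
    of it at each stage. *)
Definition invariant (n m d : nat) (s : store) : Prop :=
  [/\ ready n m d s, var_table n s, exists f, tabulates n s f &
      ~~ wide m d -> forall i, i < n -> arr s aV i = i].

Definition stage_cost (n m d : nat) : nat :=
  8 + 4 * m + 2 ^ width n m d * (10 + width n m d * 8 + m * 2)
  + width n m d * (3 + 2 ^ width n m d * 5).

Lemma stage_ok (n m d : nat) (phi : formula n) (s : store) :
  d <= n -> size phi <= m -> invariant n m d s ->
  arr s aC (var s vs) = size phi ->
  holds s aL (var s vptr) (formula_lits phi) ->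
  runs stage s (stage_cost n m d) (fun s' =>
    [/\ invariant n m d s', var s' vs = (var s vs).+1,
        var s' vptr = var s vptr + (size phi).*2 &
        forall v e, size v = width n m d -> e <= width n m d ->
          arr s' aD (pval v) <= e <->
          exists w, [/\ size w = width n m d, good (wide m d) phi w,
            arr s aD (pval w) <= radius n m d & ham w v <= e]]).
Proof.
rewrite /invariant /ready /stage_cost.
set N := width n m d; set w := wide m d; set r := radius n m d.
move=> le_dn le_m [[Ew EN Ed EM EH] EX [f Tf] EV] EC HL.
rewrite /stage; apply: (@runs_le _ _ (3 + size phi * 4 +
  (1 + 2 ^ N * (10 + N * 8 + size phi * 2) + (1 + N * (3 + 2 ^ N * 5)).+1)).+2); last first.
  have : 2 ^ N * (10 + N * 8 + size phi * 2) <= 2 ^ N * (10 + N * 8 + m * 2).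
    by rewrite leq_mul2l; apply/orP; right; lia.
  by lia.
apply: runs_assign_then; apply: runs_assign_then => /=; rewrite EC.
set s0 := setv _ vs _.
have Es0 : [/\ arr s0 = arr s, var s0 vcnt = size phi, var s0 vs = (var s vs).+1,
    var s0 vptr = var s vptr & [/\ var s0 vwide = w, var s0 vN = N, var s0 vd = r,
    var s0 vM = 2 ^ N & var s0 vH = var s vH]].
  by split=> //=; rewrite ?addn1 //.
case: Es0; move: (s0) => {}s0 Ea0 Ec0 Es0 Ep0 [Ew0 EN0 Ed0 EM0 EH0].
have HL0 : holds s0 aL (var s0 vptr) (formula_lits phi) by rewrite /holds Ea0 Ep0.
apply: runs_then (fill_ok Ew0 Ec0 HL0) _ => s1 [fv1 fa1] EV1.
(* This is the independence that [mark_all_ok] asks for: neither the old table [g] nor leftover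
   entries of [aV] influence acceptance. *)
have good1 q g : size q = N ->
    sat_formula (restrict n (assign (arr s1 aV) q g)) phi = good w phi q.
  move=> sq; apply: (sat_assign g sq).
    by rewrite /N /width -/w; case: (w); lia.
  move=> i lt_i; rewrite EV1 Ea0 /pattern_var; case Dw: (w) lt_i => /= lt_i.
    by rewrite lt_i EX // formula_lits_le.
  by rewrite EV ?Dw.
apply: (@runs_then _ _ _ _ _ (fun s' => (exists f, tabulates n s' f) /\
    forall q, size q = N -> arr s' aD (pval q) =
      if good w phi q && (arr s1 aD (pval q) <= r) then 0 else N.+1)).
  apply: mark_all_ok; rewrite ?fv1 //; first by rewrite /holds fa1.
  by exists f; move: Tf; rewrite /tabulates fa1 // Ea0.
move=> s2 [fv2 fa2] [[f2 Tf2] ED2]; apply: runs_assign_then.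
set s3 := setv s2 _ _.
have fv3 x : x != vptr -> var s3 x = var s2 x by move=> /negPf /= ->.
have EN3 : var s3 vN = N by rewrite fv3 // fv2 // fv1.
have EM3 : var s3 vM = 2 ^ N by rewrite fv3 // fv2 // fv1.
have EH3 : 0 < N -> var s3 vH = 2 ^ N.-1 by rewrite fv3 // fv2 // fv1 // EH0.
apply: runs_weaken (relax_all_ok EN3 EM3 EH3) _ _ => // s4 [fv4 fa4] ED4.
split.
- split.
  + by split; rewrite fv4 // fv3 // fv2 // fv1 // EH0.
  + by move=> l le_l; rewrite fa4 //= fa2 // fa1 // Ea0 EX.
  + by exists f2; move: Tf2; rewrite /tabulates fa4.
  move=> nw i lt_i; rewrite fa4 //= fa2 // EV1 Ea0.
  by rewrite (negPf nw) EV.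
- by rewrite fv4 // fv3 // fv2 // fv1.
- rewrite fv4 //= !fv2 // !fv1 // Ec0 Ep0; lia.
(* The bound [e <= N] excludes rejected patterns, whose cell holds [N + 1]. *)
move=> v e sv le_e; rewrite ED4 //; split=> -[p].
  case=> sp; rewrite /= ED2 // fa1 // Ea0.
  by case: ifP => [/andP[gp le_r] Hp|_]; [exists p | lia].
case=> sp gp le_r Hp; exists p; split=> //.
by rewrite /= ED2 // fa1 // Ea0 gp le_r.
Qed.

(** * Reachable patterns and the result of the program *)

(** The list has the latest stage first, so that a new stage is a new head. Before any stage every
    pattern is reachable; the first stage is thus unconstrained, a pattern being at distance 0 from
    itself. *)
Fixpoint reach (n N r : nat) (w : bool) (phis : seq (formula n)) (q : seq bool)
    : Prop :=
  if phis is phi :: phis' then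
    [/\ size q = N, good w phi q & exists2 p, reach N r w phis' p & ham p q <= r]
  else size q = N.

Lemma reach_size (n N r : nat) (w : bool) (phis : seq (formula n)) (q : seq bool) :
  reach N r w phis q -> size q = N.
Proof. by case: phis => [|phi phis] //= []. Qed.

Lemma ham_le (u v : seq bool) : size u = size v -> ham u v <= size v.
Proof.
by move=> E; rewrite (leq_trans (count_size _ _)) // size_zip E minnn.
Qed.

Lemma hamxx (u : seq bool) : ham u u = 0.
Proof. by elim: u => //= b u; rewrite /ham /= eqxx. Qed.

Lemma pval_nseq (N : nat) : pval (nseq N false) = 0.
Proof. by elim: N. Qed.

Lemma solve_ok (n d m : nat) (phis : seq (formula n)) :
  d <= n -> m = \max_(phi <- phis) size phi ->
  runs solve
    (start [:: n, d, size phis & flatten [seq encode_formula phi | phi <- phis]])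
    (17 + size phis * (7 + m * 16 + stage_cost n m d)
      + n * 5 + width n m d * 3)
    (fun s => 0 < var s vr <->
      exists q, reach (width n m d) (radius n m d) (wide m d) (rev phis) q).
Proof.
move=> le_dn Em.
have le_m phi : phi \in phis -> size phi <= m.
  by move=> phis_phi; rewrite Em (big_rem _ phis_phi) leq_maxl.
set N := width n m d; set r := radius n m d; set w := wide m d.
have le_rN : r <= N by rewrite /r /N /radius /width; case: wide.
apply: (@runs_le _ _ (4 + size phis * (6 + m * 16) + (11 + n * 5 + N * 3 +
  ((size phis * (stage_cost n m d).+1).+1 + 1)))); last by lia.
apply: runs_then (@read_input_ok n d m phis le_m) _.
move=> s1 [fv1 fa1] [[En1 Ed1] Et1 Em1 HL1 HC1].
apply: (@runs_then _ _ _ _ _ _ _ (setup_ok (m := m) En1 Ed1 _ _ _)).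
- by rewrite Em1 -Em.
- by move=> i; rewrite fa1.
- by rewrite fa1.
move=> s2 [fv2 fa2] [rdy [Ep2 Es2] EX2 Tf2 EV2].
pose I (u v : seq (formula n)) s := [/\ invariant n m d s,
  var s vs = size u, var s vptr = size (flatten [seq formula_lits phi | phi <- u]) &
  forall v e, size v = N -> e <= N -> arr s aD (pval v) <= e <->
    exists2 q, reach N r w (rev u) q & ham q v <= e].
apply: (@runs_then _ _ _ _ _ (I phis [::])).
  apply: runs_for_list; first by rewrite /= fv2.
    split=> //; first by split=> //; exists xpred0.
    (* The untouched zero table already describes the initial situation: every pattern is reachable,
       at distance 0. *)
    move=> v e sv le_e; rewrite /= fa2 // fa1 //=; split=> // _.
    by exists v => //; rewrite hamxx.
  move=> u phi v s3 def_phis [fv3 fa3] [inv Evs Evp ED].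
  apply: runs_weaken (@stage_ok n m d phi (setv s3 vt (size v)) _ _ _ _ _) _ _ => //.
  - by apply: le_m; rewrite def_phis mem_cat mem_head orbT.
  - rewrite /= Evs fa3 // fa2 //; have := HC1 (size u).
    rewrite def_phis size_map size_cat map_cat nth_cat size_map ltnn subnn /=.
    by apply; rewrite addnS ltnS leq_addr.
  - move: HL1; rewrite def_phis map_cat flatten_cat => /holds_cat[_] /=.
    by case/holds_cat; rewrite add0n /holds /= Evp fa3 // fa2.
  move=> s4 _ [inv4 Evs4 Evp4 ED4]; split=> //.
  - by rewrite Evs4 size_rcons /= Evs.
  - rewrite Evp4 map_rcons -cats1 flatten_cat size_cat /= cats0 Evp.
    by rewrite size_formula_lits.
  move=> q e sq le_e; rewrite ED4 // rev_rcons /=; split.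
    case=> p [sp gp le_p le_h]; exists p => //; split=> //.
    exact/ED.
  by case=> p [sp gp /ED H] le_h; exists p; split=> //; apply: H.
move=> s3 _ [[[_ EN _ _ _] _ _ _] _ _ ED]; apply: runs_assign => /=.
have Ea x : (0 < 1 - (x - N)) = (x <= N)
  by rewrite lt0n subn_eq0 -ltnNge ltnS leqn0 subn_eq0.
(* Cell 0 belongs to the all-false pattern. No pattern is farther than [N] from it, so the threshold
   [N] tests whether anything is reachable. *)
have H := ED (nseq N false) N (size_nseq _ _) (leqnn _).
rewrite pval_nseq in H; rewrite EN Ea; split=> [/H[q Rq _]|[q Rq]]; first by exists q.
apply/H; exists q => //; rewrite -[X in _ <= X](size_nseq N false).
by apply: ham_le; rewrite (reach_size Rq) size_nseq.
Qed.

(** * From reachable patterns to multistage solutions *)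

Fixpoint chain (n d : nat) (phis : seq (formula n)) (g : assignment n) : Prop :=
  if phis is phi :: phis' then
    sat_formula g phi /\
    exists2 f, chain d phis' f & #|[set x | f x != g x]| <= d
  else True.

Lemma chain_of_multistage (n tau d : nat) (Phi : tau.-tuple (formula n)) :
  0 < tau -> multistage_2sat d Phi -> exists g, chain d (rev Phi) g.
Proof.
case: tau Phi => // tau Phi _ [f [sat_f near_f]].
have H k (lt_k : k < tau.+1) : chain d (rev (take k.+1 Phi)) (f (Ordinal lt_k)).
  elim: k lt_k => [|k IH] lt_k; rewrite (take_nth [::]) ?size_tuple // rev_rcons /=;
    rewrite -[nth _ _ _]/(nth [::] Phi (Ordinal lt_k)) -tnth_nth; split=> //.
    (* The first stage has no predecessor in the solution, so its own assignment is used, at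
       distance 0. *)
    rewrite take0 /=; exists (f (Ordinal lt_k)) => //.
    by rewrite (_ : [set x | _] = set0) ?cards0 //; apply/setP=> x; rewrite !inE eqxx.
  by exists (f (Ordinal (ltnW lt_k))); [apply: IH | apply: near_f].
exists (f ord_max); have := H tau (ltnSn tau).
rewrite take_oversize ?size_tuple //; congr chain; congr f.
Qed.

Lemma multistage_of_chain (n tau d : nat) (Phi : tau.-tuple (formula n))
    (g : assignment n) :
  chain d (rev Phi) g -> multistage_2sat d Phi.
Proof.
have H (phis : seq (formula n)) h : chain d phis h ->
    exists F : nat -> assignment n,
    [/\ forall i, i < size phis -> sat_formula (F i) (nth [::] (rev phis) i),
        forall i, i.+1 < size phis -> #|[set x | F i x != F i.+1 x]| <= d &
        0 < size phis -> F (size phis).-1 = h].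
  elim: phis h => [|phi phis IH] h /=; first by exists (fun=> h).
  case=> sat_h [f /IH[F [sat_F near_F last_F]] near_h].
  exists (fun i => if i == size phis then h else F i); rewrite eqxx; split=> // i.
    rewrite ltnS rev_cons nth_rcons size_rev.
    by case: (ltngtP i (size phis)) => [lt_i|//|//] _; apply: sat_F.
  rewrite ltnS => lt_i; rewrite ltn_eqF //.
  case: (eqVneq i.+1 (size phis)) => [Ei|ne]; last by apply: near_F; lia.
  by move: near_h; rewrite -last_F -?Ei.
case/H=> F [sat_F near_F _]; rewrite size_rev size_tuple revK in sat_F near_F.
exists (fun i : 'I_tau => F i); split=> [i|i j Ej].
  by rewrite (tnth_nth [::]); apply: sat_F.
by have := near_F i; rewrite -Ej; apply.
Qed.

(** Each bit copies the value of [h] at the variable it controls, so repeated controls never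
    conflict. The alternative [f y = h y] carries the induction past a bit that has just been
    written. *)
Lemma pattern_exists (V : nat -> nat) (h : nat -> bool) (k : nat) :
  exists2 q, size q = k & forall f y,
    (exists2 i, i < k & V i = y) \/ f y = h y -> assign V q f y = h y.
Proof.
elim: k => [|k [q sq Hq]]; first by exists [::] => // f y [[]|].
exists (h (V k) :: q); rewrite /= ?sq // => f y Hy; apply: Hq => /=.
case: eqP => [->|ne]; [by right | case: Hy => [[i lt_i Vi]|]; last by right].
left; exists i => //; move: lt_i; rewrite ltnS leq_eqVlt => /orP[/eqP Ei|//].
by case: ne; rewrite -Vi Ei.
Qed.

Definition extend (n : nat) (g : assignment n) (x : nat) : bool :=
  if insub x is Some i then g i else false.

Lemma extendK (n : nat) (g : assignment n) : restrict n (extend g) = g.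
Proof. by apply/ffunP=> i; rewrite ffunE /extend valK. Qed.

Lemma assign_id_ge (q : seq bool) (f : nat -> bool) (y : nat) :
  size q <= y -> assign id q f y = f y.
Proof.
elim: q f => //= b q IH f lt_y; rewrite IH /=; last exact: ltnW.
by rewrite gtn_eqF.
Qed.

(** The base functions are arbitrary because the head bit modifies them in the induction; below
    [size q] they are overwritten anyway. *)
Lemma ham_sum (p q : seq bool) (f g : nat -> bool) :
  size p = size q ->
  ham p q = \sum_(x < size q) (assign id p f x != assign id q g x).
Proof.
elim: p q f g => [|b p IH] [|c q] f g //= => [_|[E]]; first by rewrite big_ord0.
rewrite big_ord_recr /= -IH // !assign_id_ge ?E //= !eqxx.
by rewrite /ham /= addnC.
Qed.

Lemma ham_card (n : nat) (p q : seq bool) :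
  size p = n -> size q = n ->
  ham p q = #|[set x | restrict n (assign id p xpred0) x
                       != restrict n (assign id q xpred0) x]|.
Proof.
move=> sp sq; rewrite (ham_sum xpred0 xpred0) ?sp // sq -sum1dep_card [RHS]big_mkcond.
by apply: eq_bigr => i _; rewrite !ffunE; case: (_ != _).
Qed.

Lemma reach_narrow (n d : nat) (phis : seq (formula n)) :
  (exists q, reach n d false phis q) <-> (exists g, chain d phis g).
Proof.
split=> [[q Hq]|[g Hg]].
  exists (restrict n (assign id q xpred0)).
  elim: phis q Hq => //= phi phis IH q [sq gq [p Rp le_d]]; split=> //.
  exists (restrict n (assign id p xpred0)); first exact: IH.
  by rewrite -ham_card // (reach_size Rp).
have pat (h : assignment n) :
    exists2 q, size q = n & restrict n (assign id q xpred0) = h.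
  have [q sq Eq] := pattern_exists id (extend h) n.
  exists q => //; rewrite -[RHS]extendK; apply/ffunP=> i.
  by rewrite !ffunE; apply: Eq; left; exists i.
have [q sq Eq] := pat g; exists q.
elim: phis g q sq Eq Hg => //= phi phis IH g q sq Eq [sat_g [f Cf le_d]].
split=> //; first by rewrite /good Eq.
have [p sp Ep] := pat f; exists p; first exact: IH Cf.
by rewrite (ham_card sp sq) Ep Eq.
Qed.

Definition satisfiable (n : nat) (phi : formula n) : Prop :=
  exists f : assignment n, sat_formula f phi.

Lemma good_satisfiable (n m : nat) (phi : formula n) :
  size phi <= m ->
  satisfiable phi <-> exists2 q, size q = 2 * m & good true phi q.
Proof.
move=> le_m; split=> [[f sat_f]|[q _ gq]]; last by eexists; exact: gq.
have [q sq Hq] := pattern_exists (pattern_var true phi) (extend f) (2 * m).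
exists q => //; rewrite -[f]extendK in sat_f.
rewrite (_ : good true phi q = sat_formula (restrict n (extend f)) phi) //.
apply: eq_sat_formula => c l phi_c c_l; apply: Hq; left.
have := mem_formula_lits phi_c c_l => L.
have lt_i := L; rewrite -index_mem size_formula_lits in lt_i.
exists (index (encode_literal l).+1 (formula_lits phi)); first lia.
by rewrite /pattern_var nth_index //= half_literal.
Qed.

(** The radius equals the pattern length, so any two patterns are close enough and the stages
    decouple. *)
Lemma reach_wide (n m : nat) (phis : seq (formula n)) :
  (forall phi, phi \in phis -> size phi <= m) ->
  (exists q, reach (2 * m) (2 * m) true phis q) <->
  (forall phi, phi \in phis -> satisfiable phi).
Proof.
elim: phis => [|phi phis IH] le_m /=.
  by split=> // _; exists (nseq (2 * m) false); rewrite size_nseq.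
have le_phi : size phi <= m by apply: le_m; rewrite mem_head.
have [psi Hpsi|to_sat of_sat] := IH; first by apply: le_m; rewrite inE Hpsi orbT.
split=> [[q [sq gq [p Rp _]]] psi|sat].
  rewrite inE => /orP[/eqP->|]; first by apply/(good_satisfiable le_phi); exists q.
  by apply: to_sat; exists p.
have [q sq gq] := (good_satisfiable le_phi).1 (sat phi (mem_head _ _)).
have [psi Hpsi|p Rp] := of_sat; first by apply: sat; rewrite inE Hpsi orbT.
exists q; split=> //; exists p => //.
by rewrite -[X in _ <= X]sq ham_le // sq (reach_size Rp).
Qed.

Definition vars (n : nat) (phi : formula n) : seq 'I_n :=
  flatten [seq [seq l.1 | l <- val c] | c <- phi].

Lemma size_vars (n : nat) (phi : formula n) : size (vars phi) <= 2 * size phi.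
Proof.
elim: phi => //= c phi IH; rewrite /vars /= size_cat size_map mulnS.
by apply: leq_add => //; apply: size_bseq.
Qed.

(** Variables that [phi] does not mention can be made false, and each clause mentions at most
    two. *)
Lemma sparse_solution (n : nat) (phi : formula n) :
  satisfiable phi ->
  exists2 g, sat_formula g phi & #|[set x | g x]| <= 2 * size phi.
Proof.
case=> f sat_f; exists [ffun x => (x \in vars phi) && f x]; last first.
  apply: leq_trans (size_vars phi); apply: leq_trans (card_size (vars phi)).
  by apply/subset_leq_card/subsetP=> x; rewrite !inE ffunE => /andP[].
rewrite (_ : sat_formula _ phi = sat_formula f phi) //.
apply: eq_in_all => c phi_c; apply: eq_in_has => l c_l.
rewrite ffunE (_ : l.1 \in vars phi) //.
by apply/flatten_mapP; exists c => //; apply: map_f.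
Qed.

Lemma chain_wide (n m d : nat) (phis : seq (formula n)) :
  4 * m <= d -> (forall phi, phi \in phis -> size phi <= m) ->
  (exists g, chain d phis g) <-> (forall phi, phi \in phis -> satisfiable phi).
Proof.
move=> le_d le_m; split=> [[g Cg] phi|sat].
  elim: phis {le_m} g Cg => //= psi phis IH g [sat_g [f Cf _]].
  by rewrite inE => /orP[/eqP->|]; [exists g | apply: IH Cf].
(* The induction also needs sparsity of the latest assignment: two assignments differ only inside
   the union of their true sets, hence in at most [4 * m] places. *)
suff [g Cg _] : exists2 g, chain d phis g & #|[set x | g x]| <= 2 * m by exists g.
elim: phis le_m sat => [|phi phis IH] le_m sat /=.
  exists [ffun=> false] => //; rewrite (_ : [set x | _] = set0) ?cards0 //.
  by apply/setP=> x; rewrite !inE ffunE.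
have [psi Hpsi|psi Hpsi|f Cf sparse_f] := IH.
- by apply: le_m; rewrite inE Hpsi orbT.
- by apply: sat; rewrite inE Hpsi orbT.
have [g sat_g sparse_g] := sparse_solution (sat phi (mem_head _ _)).
have {}sparse_g : #|[set x | g x]| <= 2 * m.
  by apply: leq_trans sparse_g _; rewrite leq_mul2l le_m ?orbT ?mem_head.
exists g => //.
split=> //; exists f => //.
apply: (@leq_trans (#|[set x | f x] :|: [set x | g x]|)).
  by apply/subset_leq_card/subsetP=> x; rewrite !inE; case: (f x) (g x) => [] [].
apply: leq_trans (leq_card_setU _ _) _; apply: leq_trans (leq_add sparse_f sparse_g) _.
by lia.
Qed.

Lemma reach_multistage (n tau d m : nat) (Phi : tau.-tuple (formula n)) :
  0 < tau -> (forall phi, phi \in Phi -> size phi <= m) ->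
  (exists q, reach (width n m d) (radius n m d) (wide m d) (rev Phi) q)
    <-> multistage_2sat d Phi.
Proof.
move=> tau_gt0 le_m.
have -> : multistage_2sat d Phi <-> exists g, chain d (rev Phi) g.
  by split=> [|[g]]; [apply: chain_of_multistage | apply: multistage_of_chain].
rewrite /width /radius; case Dw: (wide m d); last exact: reach_narrow.
have le_m' phi : phi \in rev Phi -> size phi <= m by rewrite mem_rev; apply: le_m.
by rewrite (reach_wide le_m') (chain_wide Dw le_m').
Qed.

(** * The running time *)

(** With [M] patterns, a stage costs at most [(35 + 28 + 16) * M * F], that is [79 * M * F], and the
    work outside the stages at most [(17 + 5 + 6) * F]; together this gives 107. *)
Lemma solve_cost (n d m tau : nat) :
  d <= n -> 0 < tau ->
  17 + tau * (7 + m * 16 + stage_cost n m d) + n * 5 + width n m d * 3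
    <= 107 * (4 ^ (2 * (m + n - d)) * tau * maxn 1 (n + m)).
Proof.
move=> le_dn tau_gt0; rewrite /stage_cost.
set N := width n m d; set F := maxn 1 (n + m).
have F_gt0 : 0 < F by rewrite /F leq_max.
have le_nF : n <= F /\ m <= F by rewrite /F; lia.
have le_NF : N <= 2 * F by rewrite /N /width; case: wide; lia.
have le_MG : 2 ^ N <= 4 ^ (2 * (m + n - d)).
  rewrite -[4]/(2 ^ 2) -expnM leq_exp2l // /N /width /wide.
  by case: (leqP (4 * m) d); lia.
have M_gt0 : 0 < 2 ^ N by rewrite expn_gt0.
move: (2 ^ N) (4 ^ _) M_gt0 le_MG => M G M_gt0 le_MG.
apply: (@leq_trans (107 * (M * tau * F))); last by rewrite leq_mul2l !leq_mul.
have le_MF : F <= M * F by rewrite leq_pmull.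
have le1 : M * (10 + N * 8 + m * 2) <= 28 * (M * F).
  by rewrite mulnCA leq_mul2l; apply/orP; right; lia.
have le2 : N * (3 + M * 5) <= 16 * (M * F) by nia.
have le3 : 7 + m * 16 + (8 + 4 * m + M * (10 + N * 8 + m * 2) + N * (3 + M * 5))
    <= 79 * (M * F) by lia.
have le4 : M * F <= M * tau * F by rewrite mulnAC leq_pmulr.
have : tau * (7 + m * 16 + (8 + 4 * m + M * (10 + N * 8 + m * 2) + N * (3 + M * 5)))
    <= 79 * (M * tau * F).
  apply: leq_trans (leq_mul (leqnn tau) le3) _.
  by rewrite [M * tau]mulnC -[tau * M * F]mulnA [tau * (79 * _)]mulnCA.
lia.
Qed.

(* The factor n + m is read as max(1, n + m): for n = m = 0 the bound would
   otherwise be 0, and no program halts in 0 steps. *)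
Theorem theorem4p3 :
  exists (P : program) (C : nat),
    forall (n tau d : nat) (Phi : tau.-tuple (formula n)),
      0 < tau -> d <= n ->
      let m := max_clauses Phi in
      decides_within P (encode d Phi)
        (C * (4 ^ (2 * (m + n - d)) * tau * maxn 1 (n + m)))
        (multistage_2sat d Phi).
Proof.
(* The summand 2 pays for the final jump and the halting instruction, since the bound it multiplies
   is at least 1. *)
exists (compile solve vr), (csize solve * 107 + 2) => n tau d Phi tau_gt0 le_dn m.
have Em : m = \max_(phi <- Phi) size phi by rewrite big_tuple.
have le_m phi : phi \in tval Phi -> size phi <= m.
  by move=> Phi_phi; rewrite Em (big_rem _ Phi_phi) leq_maxl.
have [le_t correct] := solve_ok le_dn Em; rewrite size_tuple in le_t correct.
have le_T := leq_trans le_t (solve_cost m le_dn tau_gt0).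
set T := _ * tau * _ in le_T *.
have T_gt0 : 0 < T by rewrite !muln_gt0 expn_gt0 tau_gt0 leq_max.
exists (0 < var (den solve (start (encode d Phi))) vr); last first.
  by rewrite correct; apply: reach_multistage.
apply: run_le (compile_ok vr wf_solve le_T).
by rewrite mulnDl mulnA leq_add2l leq_pmulr.
Qed.
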